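(* Let $p$ be a prime and $\mathfrak{o}$ the valuation ring of a perfect field of characteristic $p$ complete under a multiplicative norm $\alpha$, and assume $\mathrm{Frac}\,\mathfrak{o}$ is algebraically closed. Equip $W(\mathfrak{o})$ with $\lambda(\alpha)$. For $x\in W(\mathfrak{o})$ nonzero and not stable, we can write $x=y(p-[u_1])\cdots(p-[u_n])$ for some nonzero stable $y\in W(\mathfrak{o})$ and some $u_1,\dots,u_n\in\mathfrak{o}$ with $\alpha(u_1),\dots,\alpha(u_n)\le p^{-1}$.
   Context: $W(\mathfrak{o})$ is the ring of $p$-typical Witt vectors with multiplicative Teichmüller map $[\cdot]$; each element is uniquely $\sum_{i\ge0}p^i[\overline{x_i}]$ with $\overline{x_i}\in\mathfrak{o}$. $\lambda(\alpha)(\sum p^i[\overline{x_i}])=\max_ip^{-i}\alpha(\overline{x_i})$ (a multiplicative norm). An element $x=\sum p^i[\overline{x_i}]$ is stable if either $\alpha(\overline{x_i})=0$ for all $i$, or $\alpha(\overline{x_0})>p^{-i}\alpha(\overline{x_i})$ for all $i>0$. *)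

(* Defs.v *)
From HB Require Import structures.
From mathcomp Require Import all_boot all_order all_algebra fraction.
From mathcomp Require Import boolp classical_sets reals.
From mathcomp Require Import finmap monalg.

Set Implicit Arguments.
Unset Strict Implicit.
Unset Printing Implicit Defensive.

Import Order.TTheory GRing.Theory Num.Theory.
Local Open Scope ring_scope.

Definition zpoly (I : choiceType) : comNzRingType := {malg int[{cmonom I}]}.

HB.lock Definition zvar (I : choiceType) (i : I) : zpoly I :=
  @mkmalgU _ int (@ucm I i) 1.

Section Evaluation.
Context (I : choiceType) (R : comNzRingType) (v : I -> R).

Definition cmeval (m : cmonom I) : R := \prod_(i <- finsupp m) v i ^+ m i.

Lemma cmevalEw (d : {fset I}) (m : cmonom I) : (finsupp m `<=` d)%fset ->
  cmeval m = \prod_(i <- d) v i ^+ m i.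
Proof.
move=> le; rewrite /cmeval (big_fset_incl _ le) //= => i _.
by rewrite -cmE_eq0 => /eqP->; rewrite expr0.
Qed.

Lemma cmeval_mmorphism : mmorphism cmeval.
Proof.
split=> [m1 m2|]; last by rewrite /cmeval mdom1 big_seq_fset0.
rewrite (@cmevalEw (finsupp m1 `|` finsupp m2)%fset (mmul m1 m2)); last first.
  by rewrite mdomD fsubset_refl.
rewrite (@cmevalEw (finsupp m1 `|` finsupp m2)%fset m1) ?fsubsetUl //.
rewrite (@cmevalEw (finsupp m1 `|` finsupp m2)%fset m2) ?fsubsetUr //.
by rewrite -big_split /=; apply: eq_bigr => i _; rewrite cmM exprD.
Qed.

HB.instance Definition _ := isMultiplicative.Build _ _ cmeval cmeval_mmorphism.

Definition zeval : zpoly I -> R := mmap intr cmeval.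

HB.instance Definition _ := GRing.RMorphism.on zeval.

Lemma zeval_var i : zeval (zvar i) = v i.
Proof.
rewrite zvar.unlock /zeval mmapU mul1r /cmeval mdomU big_seq_fset1.
by rewrite cmUU expr1.
Qed.

End Evaluation.

Lemma rmorph_zeval (I : choiceType) (R S : comNzRingType)
    (f : {rmorphism R -> S}) (v : I -> R) (g : zpoly I) :
  f (zeval v g) = zeval (f \o v) g.
Proof.
rewrite /zeval /mmap rmorph_sum; apply: eq_bigr => m _.
rewrite rmorphM rmorph_int; congr (_ * _).
by rewrite /cmeval rmorph_prod; apply: eq_bigr => i _; rewrite rmorphXn.
Qed.

(* The value at w of the n-th Witt polynomial \sum_(i <= n) p^i X_i^(p^(n-i)). *)
Definition ghost (p : nat) (R : comNzRingType) (w : nat -> R) (n : nat) : R :=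
  \sum_(i < n.+1) (w i ^+ (p ^ (n - i))) *+ p ^ i.

Lemma rmorph_ghost p (R S : comNzRingType) (f : {rmorphism R -> S}) w n :
  f (ghost p w n) = ghost p (f \o w) n.
Proof. by rewrite rmorph_sum; apply: eq_bigr => i _; rewrite rmorphMn rmorphXn. Qed.

Lemma eq_ghost p (R : comNzRingType) (w w' : nat -> R) n :
  (forall i, (i <= n)%N -> w i = w' i) -> ghost p w n = ghost p w' n.
Proof. by move=> e; apply: eq_bigr => i _; rewrite e // -ltnS. Qed.

Lemma ghostS p (R : comNzRingType) (w : nat -> R) n :
  ghost p w n.+1 = ghost p (fun i => w i ^+ p) n + w n.+1 *+ p ^ n.+1.
Proof.
rewrite /ghost big_ord_recr /= subnn expn0 expr1; congr (_ + _).
apply: eq_bigr => i _; rewrite -exprM -expnS subSn //.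
by rewrite -ltnS.
Qed.

Section Congruence.
Context (p : nat) (A : comNzRingType).
Implicit Types (a b c : A) (w g : nat -> A).

Definition pcong n a b := exists c, a = b + c *+ p ^ n.

Lemma pcong_refl n a : pcong n a a.
Proof. by exists 0; rewrite mul0rn addr0. Qed.

Lemma pcong_sym n a b : pcong n a b -> pcong n b a.
Proof. by case=> c ->; exists (- c); rewrite mulNrn addrK. Qed.

Lemma pcong_trans n a b c : pcong n a b -> pcong n b c -> pcong n a c.
Proof.
by case=> x -> [y ->]; exists (y + x); rewrite mulrnDl addrA.
Qed.

Lemma pcongD n a b a' b' :
  pcong n a b -> pcong n a' b' -> pcong n (a + a') (b + b').
Proof. by case=> x -> [y ->]; exists (x + y); rewrite mulrnDl addrACA. Qed.

Lemma pcongN n a b : pcong n a b -> pcong n (- a) (- b).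
Proof. by case=> x ->; exists (- x); rewrite mulNrn opprD. Qed.

Lemma pcongM n a b a' b' :
  pcong n a b -> pcong n a' b' -> pcong n (a * a') (b * b').
Proof.
case=> x -> [y ->]; exists (b * y + x * (b' + y *+ p ^ n)).
by rewrite mulrDl mulrDr mulrnDl -addrA -mulrnAr mulrnAl.
Qed.

Lemma pcong_sum n (I : Type) (r : seq I) (P : pred I) (F G : I -> A) :
  (forall i, P i -> pcong n (F i) (G i)) ->
  pcong n (\sum_(i <- r | P i) F i) (\sum_(i <- r | P i) G i).
Proof.
move=> FG; elim/big_ind2: _ => // [|x x' y y']; first exact: pcong_refl.
exact: pcongD.
Qed.

Lemma pcongMn n k a b : pcong n a b -> pcong (n + k) (a *+ p ^ k) (b *+ p ^ k).
Proof. by case=> c ->; exists c; rewrite mulrnDl -mulrnA expnD. Qed.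

Lemma pcong_leq m n a b : (m <= n)%N -> pcong n a b -> pcong m a b.
Proof.
move=> mn [c ->]; exists (c *+ p ^ (n - m)).
by rewrite -mulrnA -expnD subnK.
Qed.

Lemma pcongX n a b k : pcong n a b -> pcong n (a ^+ k) (b ^+ k).
Proof.
move=> ab; elim: k => [|k IH]; first exact: pcong_refl.
by rewrite !exprS; apply: pcongM.
Qed.

Lemma pcong_expp n a b : pcong n.+1 a b -> pcong n.+2 (a ^+ p) (b ^+ p).
Proof.
move=> ab; case: (ab) => c abE.
have : pcong 1 (\sum_(i < p) a ^+ (p.-1 - i) * b ^+ i) 0.
  apply: (@pcong_trans _ _ (\sum_(i < p) b ^+ p.-1)).
    apply: pcong_sum => i _.
    have -> : b ^+ p.-1 = b ^+ (p.-1 - i) * b ^+ i.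
      by rewrite -exprD subnK //; case: (p) i => [|q] i; [case: i | rewrite /= -ltnS].
    apply: pcongM; last exact: pcong_refl.
    by apply: pcongX; apply: pcong_leq ab.
  by exists (b ^+ p.-1); rewrite sumr_const card_ord add0r expn1.
case=> d; rewrite add0r expn1 => dE; exists (c * d).
apply/eqP; rewrite addrC -subr_eq subrXX dE abE addrC addKr.
by rewrite mulrnAl mulrnAr -mulrnA -expnS.
Qed.

Lemma pcong_exppn n a b : pcong 1 a b -> pcong n.+1 (a ^+ (p ^ n)) (b ^+ (p ^ n)).
Proof.
move=> ab; elim: n => [|n IH]; first by rewrite expn0 !expr1.
by rewrite expnSr !exprM; apply: pcong_expp.
Qed.

Lemma pcong_ghost w w' n : (forall i, (i <= n)%N -> pcong 1 (w i) (w' i)) ->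
  pcong n.+1 (ghost p w n) (ghost p w' n).
Proof.
move=> ww'; apply: pcong_sum => i _.
have ni : (i <= n)%N by rewrite -ltnS.
apply: (@pcong_leq _ ((n - i).+1 + i)); first by rewrite addSn subnK.
by apply: pcongMn; apply: pcong_exppn; apply: ww'.
Qed.

Hypothesis A_tf : forall a, a *+ p = 0 -> a = 0.

Lemma tf_exp a n : a *+ p ^ n = 0 -> a = 0.
Proof.
elim: n => [|n IH]; first by rewrite expn0.
by rewrite expnSr mulrnA => /A_tf/IH.
Qed.

Lemma ghostE w n : ghost p w n =
  \sum_(i < n) (w i ^+ (p ^ (n - i))) *+ p ^ i + w n *+ p ^ n.
Proof. by rewrite /ghost big_ord_recr /= subnn expn0 expr1. Qed.

Lemma ghost_inj w w' : (forall n, ghost p w n = ghost p w' n) -> w =1 w'.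
Proof.
move=> e n; elim/ltn_ind: n => n IH.
have /eqP := e n; rewrite !ghostE.
rewrite (eq_bigr (fun i : 'I_n => (w' i ^+ (p ^ (n - i))) *+ p ^ i)); last first.
  by move=> i _; rewrite IH.
rewrite (inj_eq (addrI _)) -subr_eq0 -mulrnBl => /eqP /tf_exp /eqP.
by rewrite subr_eq0 => /eqP.
Qed.

Lemma ghost_inj_mod w w' :
  (forall n, pcong n.+1 (ghost p w n) (ghost p w' n)) ->
  forall n, pcong 1 (w n) (w' n).
Proof.
move=> e n; elim/ltn_ind: n => n IH.
have h : pcong n.+1 (\sum_(i < n) (w i ^+ (p ^ (n - i))) *+ p ^ i)
                    (\sum_(i < n) (w' i ^+ (p ^ (n - i))) *+ p ^ i).
  apply: pcong_sum => i _.
  apply: (@pcong_leq _ ((n - i).+1 + i)).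
    by rewrite addSn subnK // ltnW.
  by apply: pcongMn; apply: pcong_exppn; apply: IH.
have := pcongD (e n) (pcongN h); rewrite !ghostE [_ + w n *+ _]addrC.
rewrite [_ + w' n *+ _]addrC !addrK => -[c /eqP].
rewrite -subr_eq0 expnS mulrnA -mulrnDl -mulrnBl => /eqP /tf_exp /eqP.
by rewrite subr_eq0 => /eqP ->; exists c; rewrite expn1.
Qed.

Context (phi : {rmorphism A -> A}).
Hypothesis phiP : forall a, pcong 1 (a ^+ p) (phi a).

Lemma ghost_frob w n : pcong n.+1 (ghost p w n.+1) (phi (ghost p w n)).
Proof.
rewrite ghostS rmorph_ghost.
apply: (@pcong_trans _ _ (ghost p (fun i => w i ^+ p) n)).
  by exists (w n.+1).
by apply: pcong_ghost => i _; apply: phiP.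
Qed.

(* Dwork's lemma. *)
Lemma ghost_surj g : (forall n, pcong n.+1 (g n.+1) (phi (g n))) ->
  exists w, forall n, ghost p w n = g n.
Proof.
move=> gP.
pose h n a : A := xget 0 [set q | a = q *+ p ^ n]%classic.
have hP n a : pcong n a 0 -> a = h n a *+ p ^ n.
  by case=> c; rewrite add0r => aE; rewrite /h; case: xgetP => // /(_ c).
pose s := fix s n := if n is m.+1 then
  rcons (s m) (h m (g m - \sum_(i < m) ((s m)`_i ^+ (p ^ (m - i))) *+ p ^ i))
  else [::].
have szs n : size (s n) = n by elim: n => //= n IH; rewrite size_rcons IH.
have sE n i : (i < n)%N -> (s n)`_i = (s i.+1)`_i.
  elim: n => // n IH; rewrite ltnS leq_eqVlt => /orP[/eqP->//|lin].
  by rewrite -IH //= nth_rcons szs lin.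
pose w n := (s n.+1)`_n; exists w.
have wE n : w n = h n (g n - \sum_(i < n) (w i ^+ (p ^ (n - i))) *+ p ^ i).
  rewrite /w /= nth_rcons szs ltnn eqxx; congr (h n (_ - _)).
  by apply: eq_bigr => i _; rewrite sE.
elim=> [|n IH].
  rewrite ghostE big_ord0 add0r wE big_ord0 subr0 -hP //.
  by exists (g 0%N); rewrite add0r expn0.
rewrite ghostE [w n.+1]wE -hP ?(addrC _ (g n.+1 - _)) ?subrK //.
set u := \sum_(i < _) _.
have -> : u = ghost p (fun i => w i ^+ p) n.
  apply: eq_bigr => i _; rewrite -exprM -expnS subSn //.
  by rewrite -ltnS.
rewrite -(subrr (phi (g n))); apply: pcongD; first exact: gP.
apply/pcongN/pcong_sym; rewrite -IH rmorph_ghost.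
by apply/pcong_sym/pcong_ghost => i _; apply: phiP.
Qed.

End Congruence.

Section FrobeniusLift.
Context (p : nat) (p_pr : prime p) (A : comNzRingType) (phi : {rmorphism A -> A}).
Implicit Types a b : A.

Lemma pcong_exprD a b :
  pcong p 1 ((a + b) ^+ p) (a ^+ p + b ^+ p).
Proof.
case: p p_pr => // q q_pr.
rewrite exprDn big_ord_recl big_ord_recr /= bin0 binn subnn subn0 !expr0.
rewrite mulr1 mul1r !mulr1n.
apply: pcongD; first exact: pcong_refl.
rewrite -[X in pcong _ _ _ X]add0r.
apply: pcongD; last exact: pcong_refl.
rewrite -[X in pcong _ _ _ X](@big1_eq _ _ +%R _ (index_enum 'I_q) predT).
apply: pcong_sum => i _.
have /dvdnP[k ->] : (q.+1 %| 'C(q.+1, bump 0 i))%N.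
  by apply: prime_dvd_bin => //; rewrite /bump /= add1n ltnS ltn_ord.
by eexists; rewrite add0r mulrnA expn1.
Qed.

Definition frob_at a := pcong p 1 (a ^+ p) (phi a).

Lemma frob_at0 : frob_at 0.
Proof.
by rewrite /frob_at rmorph0 expr0n eqn0Ngt prime_gt0 //; exact: pcong_refl.
Qed.

Lemma frob_at1 : frob_at 1.
Proof. by rewrite /frob_at expr1n rmorph1; exact: pcong_refl. Qed.

Lemma frob_atD a b : frob_at a -> frob_at b -> frob_at (a + b).
Proof.
move=> Ea Eb; rewrite /frob_at rmorphD.
by apply: pcong_trans (pcong_exprD a b) _; exact: pcongD.
Qed.

Lemma frob_atN a : frob_at a -> frob_at (- a).
Proof.
move=> Ea; have := pcong_exprD a (- a).
rewrite subrr expr0n eqn0Ngt prime_gt0 //= => h.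
have := pcongD (pcong_refl p 1 (- a ^+ p)) h.
rewrite addr0 addKr => /pcong_sym h'.
by rewrite /frob_at rmorphN; apply: pcong_trans h' _; exact: pcongN.
Qed.

Lemma frob_atM a b : frob_at a -> frob_at b -> frob_at (a * b).
Proof. by move=> Ea Eb; rewrite /frob_at rmorphM exprMn; apply: pcongM. Qed.

Lemma frob_at_int (z : int) : frob_at z%:~R.
Proof.
have En n : frob_at n%:R.
  elim: n => [|n IH]; first exact: frob_at0.
  by rewrite -addn1 natrD; apply: frob_atD => //; exact: frob_at1.
by case: z => n; rewrite ?NegzE ?mulrNz; [apply: En | apply/frob_atN/En].
Qed.

Lemma frob_at_sum (I : Type) (r : seq I) (F : I -> A) :
  (forall i, frob_at (F i)) -> frob_at (\sum_(i <- r) F i).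
Proof.
move=> FP; elim/big_ind: _ => //; [exact: frob_at0 | exact: frob_atD].
Qed.

End FrobeniusLift.

Section ZpolyFrobenius.
Context (p : nat) (p_pr : prime p) (I : choiceType).
Implicit Types a b : zpoly I.

Lemma zpoly_tf a : a *+ p = 0 -> a = 0.
Proof.
move=> ap0; apply/malgP => k; rewrite mcoeff0; apply/eqP.
have /eqP : (a *+ p)@_k = 0 by rewrite ap0 mcoeff0.
by rewrite mcoeffMn mulrn_eq0 eqn0Ngt prime_gt0.
Qed.

(* zfrob lifts the Frobenius: it is the ring endomorphism X_i |-> X_i ^+ p.  *)
Definition zfrob_mon (m : cmonom I) : zpoly I := (@mkmalgU _ int m 1) ^+ p.

Lemma zfrob_mon_mmorphism : mmorphism zfrob_mon.
Proof.
split=> [m1 m2|]; last by rewrite /zfrob_mon expr1n.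
by rewrite /zfrob_mon -exprMn malgM_def fgmulUU mulr1.
Qed.

HB.instance Definition _ :=
  isMultiplicative.Build _ _ zfrob_mon zfrob_mon_mmorphism.

Definition zfrob : zpoly I -> zpoly I := mmap intr zfrob_mon.

HB.instance Definition _ := GRing.RMorphism.on zfrob.

Lemma zfrobP a : pcong p 1 (a ^+ p) (zfrob a).
Proof.
rewrite -/(frob_at p zfrob a) (monalgE a); apply: frob_at_sum => // m.
have -> : @mkmalgU _ int m (a@_m) = (a@_m)%:~R * @mkmalgU _ int m 1.
  by rewrite mulrzl -raddfMz intz.
apply: frob_atM; first exact: frob_at_int.
by rewrite /frob_at /= /zfrob mmapU mul1r; exact: pcong_refl.
Qed.

End ZpolyFrobenius.

Section WittPolynomials.
Context (p : nat).

Definition wittX (n : nat) : zpoly (bool * nat)%type := zvar (true, n).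
Definition wittY (n : nat) : zpoly (bool * nat)%type := zvar (false, n).

(* The sequence of integer polynomials whose ghost components are g: unique  *)
(* by ghost_inj, and 0 by default if there is none.                          *)
Definition unghost (g : nat -> zpoly (bool * nat)%type) :
    nat -> zpoly (bool * nat)%type :=
  xget (fun=> 0) [set w | forall n, ghost p w n = g n]%classic.

(* Unlike ghost_addP, ghost_mulP and ghost_oppP below, these definitions do   *)
(* not use that p is prime.                                                  *)
Definition witt_addP := unghost (fun n => ghost p wittX n + ghost p wittY n).
Definition witt_mulP := unghost (fun n => ghost p wittX n * ghost p wittY n).
Definition witt_oppP := unghost (fun n => - ghost p wittX n).

Hypothesis p_pr : prime p.

Lemma unghostK g :
  (forall n, pcong p n.+1 (g n.+1) (zfrob p (g n))) ->
  forall n, ghost p (unghost g) n = g n.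
Proof.
move=> /(ghost_surj (zfrobP p_pr (I := _)))[w wP].
by rewrite /unghost; case: xgetP => [w' _ w'P|/(_ w)/(_ wP)[]]; exact: w'P.
Qed.

Lemma ghost_addP n : ghost p witt_addP n = ghost p wittX n + ghost p wittY n.
Proof.
apply: (unghostK (g := fun n => ghost p wittX n + ghost p wittY n)) => {}n.
rewrite rmorphD; apply: pcongD; apply: ghost_frob; exact: zfrobP.
Qed.

Lemma ghost_mulP n : ghost p witt_mulP n = ghost p wittX n * ghost p wittY n.
Proof.
apply: (unghostK (g := fun n => ghost p wittX n * ghost p wittY n)) => {}n.
rewrite rmorphM; apply: pcongM; apply: ghost_frob; exact: zfrobP.
Qed.

Lemma ghost_oppP n : ghost p witt_oppP n = - ghost p wittX n.
Proof.
apply: (unghostK (g := fun n => - ghost p wittX n)) => {}n.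
rewrite rmorphN; apply: pcongN; apply: ghost_frob; exact: zfrobP.
Qed.

End WittPolynomials.

(* p_pr is a parameter of the type because the ring structure depends on it. *)

Record witt (p : nat) (p_pr : prime p) (R : comNzRingType) : Type :=
  Witt { wcoord : nat -> R }.
Arguments Witt {p} p_pr {R} wcoord.

HB.instance Definition _ p (p_pr : prime p) R := gen_eqMixin (witt p_pr R).
HB.instance Definition _ p (p_pr : prime p) R := gen_choiceMixin (witt p_pr R).

Lemma wittP p (p_pr : prime p) (R : comNzRingType) (x y : witt p_pr R) :
  wcoord x =1 wcoord y -> x = y.
Proof. by case: x y => [x] [y] /= /funext->. Qed.

Definition weval p (p_pr : prime p) (R : comNzRingType) (x y : witt p_pr R) :
    zpoly (bool * nat)%type -> R :=
  zeval (fun i => if i.1 then wcoord x i.2 else wcoord y i.2).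

HB.instance Definition _ p (p_pr : prime p) R (x y : witt p_pr R) :=
  GRing.RMorphism.on (weval x y).

(* Locked: otherwise unification unfolds them down to integer polynomials.   *)
HB.lock Definition wadd p (p_pr : prime p) (R : comNzRingType)
    (x y : witt p_pr R) : witt p_pr R :=
  Witt p_pr (fun n => weval x y (witt_addP p n)).

HB.lock Definition wmul p (p_pr : prime p) (R : comNzRingType)
    (x y : witt p_pr R) : witt p_pr R :=
  Witt p_pr (fun n => weval x y (witt_mulP p n)).

HB.lock Definition wopp p (p_pr : prime p) (R : comNzRingType)
    (x : witt p_pr R) : witt p_pr R :=
  Witt p_pr (fun n => weval x x (witt_oppP p n)).

Definition wzero p (p_pr : prime p) (R : comNzRingType) : witt p_pr R :=
  Witt p_pr (fun=> 0).

Definition teich p (p_pr : prime p) (R : comNzRingType) (a : R) : witt p_pr R :=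
  Witt p_pr (fun n => if n is 0 then a else 0).

Arguments wzero {p} p_pr R.
Arguments teich {p} p_pr {R} a.

Section WittOps.
Context (p : nat) (p_pr : prime p) (R : comNzRingType).
Implicit Types (x y : witt p_pr R) (a : R).

Lemma wcoordD x y n : wcoord (wadd x y) n = weval x y (witt_addP p n).
Proof. by rewrite wadd.unlock. Qed.

Lemma wcoordM x y n : wcoord (wmul x y) n = weval x y (witt_mulP p n).
Proof. by rewrite wmul.unlock. Qed.

Lemma wcoordN x n : wcoord (wopp x) n = weval x x (witt_oppP p n).
Proof. by rewrite wopp.unlock. Qed.

Lemma weval_ghostX x y n : weval x y (ghost p wittX n) = ghost p (wcoord x) n.
Proof. by rewrite rmorph_ghost; apply: eq_ghost => i _; rewrite /= /weval zeval_var. Qed.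

Lemma weval_ghostY x y n : weval x y (ghost p wittY n) = ghost p (wcoord y) n.
Proof. by rewrite rmorph_ghost; apply: eq_ghost => i _; rewrite /= /weval zeval_var. Qed.

Lemma ghost_wadd x y n : ghost p (wcoord (wadd x y)) n =
  ghost p (wcoord x) n + ghost p (wcoord y) n.
Proof.
rewrite -(weval_ghostX x y) -(weval_ghostY x y) -(rmorphD (weval x y)).
rewrite -(ghost_addP p_pr) (rmorph_ghost p (weval x y)).
by apply: eq_ghost => i _; exact: wcoordD.
Qed.

Lemma ghost_wmul x y n : ghost p (wcoord (wmul x y)) n =
  ghost p (wcoord x) n * ghost p (wcoord y) n.
Proof.
rewrite -(weval_ghostX x y) -(weval_ghostY x y) -(rmorphM (weval x y)).
rewrite -(ghost_mulP p_pr) (rmorph_ghost p (weval x y)).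
by apply: eq_ghost => i _; exact: wcoordM.
Qed.

Lemma ghost_wopp x n : ghost p (wcoord (wopp x)) n = - ghost p (wcoord x) n.
Proof. rewrite -(weval_ghostX x x) -(rmorphN (weval x x)) -(ghost_oppP p_pr).
rewrite (rmorph_ghost p (weval x x)).
by apply: eq_ghost => i _; exact: wcoordN. Qed.

Lemma ghost_teich a n : ghost p (wcoord (teich p_pr a)) n = a ^+ (p ^ n).
Proof.
rewrite /ghost big_ord_recl /= subn0 expn0 mulr1n big1 ?addr0 // => i _.
by rewrite expr0n expn_eq0 eqn0Ngt prime_gt0 //= mul0rn.
Qed.

Lemma ghost_wzero n : ghost p (wcoord (wzero p_pr R)) n = 0.
Proof.
rewrite /ghost big1 // => i _.
by rewrite expr0n expn_eq0 eqn0Ngt prime_gt0 //= mul0rn.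
Qed.

End WittOps.

Section WittFunctoriality.
Context (p : nat) (p_pr : prime p) (R S : comNzRingType) (f : {rmorphism R -> S}).
Implicit Types (x y : witt p_pr R).

Definition wmap x : witt p_pr S := Witt p_pr (f \o wcoord x).

Lemma weval_wmap x y g : f (weval x y g) = weval (wmap x) (wmap y) g.
Proof.
rewrite rmorph_zeval /weval; congr (zeval _ _).
by apply/funext => -[[] n].
Qed.

Lemma wmapD x y : wmap (wadd x y) = wadd (wmap x) (wmap y).
Proof. by apply: wittP => n; rewrite /= !wcoordD weval_wmap. Qed.

Lemma wmapM x y : wmap (wmul x y) = wmul (wmap x) (wmap y).
Proof. by apply: wittP => n; rewrite /= !wcoordM weval_wmap. Qed.

Lemma wmapN x : wmap (wopp x) = wopp (wmap x).
Proof. by apply: wittP => n; rewrite /= !wcoordN weval_wmap. Qed.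

Lemma wmap_teich a : wmap (teich p_pr a) = teich p_pr (f a).
Proof. by apply: wittP => -[|n] //=; rewrite rmorph0. Qed.

Lemma wmap0 : wmap (wzero p_pr R) = wzero p_pr S.
Proof. by apply: wittP => n /=; rewrite rmorph0. Qed.

End WittFunctoriality.

Section WittLift.
Context (p : nat) (p_pr : prime p) (R : comNzRingType).

Definition wlift (x : witt p_pr R) : witt p_pr (zpoly R) :=
  Witt p_pr (fun n => zvar (wcoord x n)).

Definition zproj : zpoly R -> R := zeval (@id R).

HB.instance Definition _ := GRing.RMorphism.on zproj.

Lemma zproj_var r : zproj (zvar r) = r.
Proof. exact: zeval_var. Qed.

Lemma wliftK : cancel wlift (wmap zproj).
Proof. by move=> x; apply: wittP => n /=; rewrite zproj_var. Qed.

Lemma wghost_inj (I : choiceType) (x y : witt p_pr (zpoly I)) :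
  (forall n, ghost p (wcoord x) n = ghost p (wcoord y) n) -> x = y.
Proof. by move=> /ghost_inj xy; apply/wittP/xy/zpoly_tf. Qed.

End WittLift.

Section WittRing.
Context (p : nat) (p_pr : prime p) (R : comNzRingType).

Let waddA : associative (@wadd p p_pr R).
Proof.
move=> x y z; rewrite -(wliftK x) -(wliftK y) -(wliftK z) -!wmapD.
apply: (congr1 (wmap (@zproj R))); apply: wghost_inj => n.
by rewrite !ghost_wadd addrA.
Qed.

Let waddC : commutative (@wadd p p_pr R).
Proof.
move=> x y; rewrite -(wliftK x) -(wliftK y) -!wmapD.
apply: (congr1 (wmap (@zproj R))); apply: wghost_inj => n.
by rewrite !ghost_wadd; exact: addrC.
Qed.

Let wadd0 : left_id (wzero p_pr R) (@wadd p p_pr R).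
Proof.
move=> x; rewrite -(wliftK x) -(wmap0 p_pr (@zproj R)) -!wmapD.
apply: (congr1 (wmap (@zproj R))); apply: wghost_inj => n.
by rewrite !ghost_wadd ghost_wzero add0r.
Qed.

Let waddN : left_inverse (wzero p_pr R) (@wopp p p_pr R) (@wadd p p_pr R).
Proof.
move=> x; rewrite -(wliftK x) -(wmap0 p_pr (@zproj R)) -wmapN -!wmapD.
apply: (congr1 (wmap (@zproj R))); apply: wghost_inj => n.
by rewrite !ghost_wadd ghost_wopp ghost_wzero addNr.
Qed.

HB.instance Definition _ := GRing.isZmodule.Build (witt p_pr R) waddA waddC wadd0 waddN.

Let wmulA : associative (@wmul p p_pr R).
Proof.
move=> x y z; rewrite -(wliftK x) -(wliftK y) -(wliftK z) -!wmapM.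
apply: (congr1 (wmap (@zproj R))); apply: wghost_inj => n.
by rewrite !ghost_wmul mulrA.
Qed.

Let wmulC : commutative (@wmul p p_pr R).
Proof.
move=> x y; rewrite -(wliftK x) -(wliftK y) -!wmapM.
apply: (congr1 (wmap (@zproj R))); apply: wghost_inj => n.
by rewrite !ghost_wmul; exact: mulrC.
Qed.

Let wmul1 : left_id (teich p_pr (1 : R)) (@wmul p p_pr R).
Proof.
move=> x; rewrite -(wliftK x) -(rmorph1 (@zproj R)) -wmap_teich -!wmapM.
apply: (congr1 (wmap (@zproj R))); apply: wghost_inj => n.
by rewrite !ghost_wmul ghost_teich expr1n mul1r.
Qed.

Let wmulDl : left_distributive (@wmul p p_pr R) (@wadd p p_pr R).
Proof.
move=> x y z; rewrite -(wliftK x) -(wliftK y) -(wliftK z).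
rewrite -wmapD -!wmapM -wmapD; apply: (congr1 (wmap (@zproj R))); apply: wghost_inj => n.
by rewrite !(ghost_wadd, ghost_wmul) mulrDl.
Qed.

Let wone_neq0 : teich p_pr (1 : R) != (0 : witt p_pr R).
Proof.
apply/eqP => /(congr1 (fun x : witt p_pr R => wcoord x 0)) /= /eqP.
by rewrite oner_eq0.
Qed.

HB.instance Definition _ :=
  GRing.Zmodule_isComNzRing.Build (witt p_pr R) wmulA wmulC wmul1 wmulDl wone_neq0.

End WittRing.

Section WittTheory.
Context (p : nat) (p_pr : prime p).

Definition wghost (R : comNzRingType) n (x : witt p_pr R) : R :=
  ghost p (wcoord x) n.

Section WghostMorphism.
Context (R : comNzRingType) (n : nat).

Fact wghost_zmod_morphism : zmod_morphism (@wghost R n).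
Proof. by move=> x y; rewrite /wghost ghost_wadd ghost_wopp. Qed.

Fact wghost_monoid_morphism : monoid_morphism (@wghost R n).
Proof.
split=> [|x y]; last exact: ghost_wmul.
by rewrite /wghost ghost_teich expr1n.
Qed.

HB.instance Definition _ :=
  GRing.isZmodMorphism.Build _ _ (@wghost R n) wghost_zmod_morphism.
HB.instance Definition _ :=
  GRing.isMonoidMorphism.Build _ _ (@wghost R n) wghost_monoid_morphism.

End WghostMorphism.

Section WmapMorphism.
Context (R S : comNzRingType) (f : {rmorphism R -> S}).

Fact wmap_zmod_morphism : zmod_morphism (@wmap p p_pr _ _ f).
Proof. by move=> x y; rewrite [LHS]wmapD wmapN. Qed.

Fact wmap_monoid_morphism : monoid_morphism (@wmap p p_pr _ _ f).
Proof.
by split=> [|x y]; [rewrite [LHS]wmap_teich rmorph1 | exact: wmapM].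
Qed.

HB.instance Definition _ :=
  GRing.isZmodMorphism.Build _ _ (@wmap p p_pr _ _ f) wmap_zmod_morphism.
HB.instance Definition _ :=
  GRing.isMonoidMorphism.Build _ _ (@wmap p p_pr _ _ f) wmap_monoid_morphism.

End WmapMorphism.

Lemma wcoord_teich0 (R : comNzRingType) (a : R) : wcoord (teich p_pr a) 0 = a.
Proof. by []. Qed.

Lemma wghost0E (R : comNzRingType) (x : witt p_pr R) : wghost 0 x = wcoord x 0.
Proof. by rewrite /wghost /ghost big_ord1 expr1. Qed.

Lemma teichM (R : comNzRingType) (a b : R) :
  teich p_pr (a * b) = teich p_pr a * teich p_pr b.
Proof.
rewrite -{1}(zproj_var a) -{1}(zproj_var b) -rmorphM -wmap_teich.
rewrite -[in RHS](zproj_var a) -[in RHS](zproj_var b) -!wmap_teich -rmorphM.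
apply: (congr1 (wmap (@zproj R))); apply: wghost_inj => n.
by rewrite ghost_wmul !ghost_teich exprMn.
Qed.

Definition versch (R : comNzRingType) (x : witt p_pr R) : witt p_pr R :=
  Witt p_pr (fun n => if n is m.+1 then wcoord x m else 0).

Lemma ghost_versch (R : comNzRingType) (x : witt p_pr R) n :
  ghost p (wcoord (versch x)) n.+1 = ghost p (wcoord x) n *+ p.
Proof.
rewrite /ghost big_ord_recl /= subn0 expr0n expn_eq0 eqn0Ngt prime_gt0 //=.
rewrite mul0rn add0r -sumrMnl; apply: eq_bigr => i _.
by rewrite -mulrnA -expnSr.
Qed.

Lemma witt_decomp (R : comNzRingType) (x : witt p_pr R) :
  x = teich p_pr (wcoord x 0) + versch (Witt p_pr (wcoord x \o succn)).
Proof.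
rewrite -[x in LHS]wliftK.
have -> : teich p_pr (wcoord x 0) =
    wmap (@zproj R) (teich p_pr (wcoord (wlift x) 0)).
  by rewrite wmap_teich /= zproj_var.
have -> : versch (Witt p_pr (wcoord x \o succn)) =
    wmap (@zproj R) (versch (Witt p_pr (wcoord (wlift x) \o succn))).
  by apply: wittP => -[|n] /=; rewrite ?rmorph0 // zproj_var.
rewrite -rmorphD; apply: (congr1 (wmap (@zproj R))); apply: wghost_inj => n.
rewrite ghost_wadd ghost_teich; case: n => [|n].
  by rewrite /ghost !big_ord1 /= !expr1 addr0.
rewrite ghost_versch /ghost big_ord_recl /= subn0 mulr1n; congr (_ + _).
rewrite -sumrMnl; apply: eq_bigr => i _.
by rewrite -mulrnA -expnSr.
Qed.

Section CharP.
Context (R : comNzRingType) (pcharR : p \in [pchar R]).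
Implicit Types x y : witt p_pr R.

Lemma zproj_pcong a b : pcong p 1 a b -> @zproj R a = zproj b.
Proof.
case=> c ->; rewrite rmorphD rmorphMn expn1.
by rewrite -mulr_natr (pcharf0 pcharR) mulr0 addr0.
Qed.

Definition wfrob x : witt p_pr R := Witt p_pr (fun n => wcoord x n ^+ p).

Lemma witt_mulrp x : x *+ p = versch (wfrob x).
Proof.
rewrite -{1}(wliftK x) -rmorphMn.
pose y := versch (Witt p_pr (fun n => wcoord (wlift x) n ^+ p)).
have -> : versch (wfrob x) = wmap (@zproj R) y.
  by apply: wittP => -[|n] /=; rewrite ?rmorph0 // (rmorphXn (@zproj R)) /= zproj_var.
apply: wittP => n; apply: (@zproj_pcong (wcoord (wlift x *+ p) n) (wcoord y n)).
move: n; apply: (ghost_inj_mod (zpoly_tf p_pr (I := R))) => n.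
have -> : ghost p (wcoord (wlift x *+ p)) n = ghost p (wcoord (wlift x)) n *+ p.
  exact: (rmorphMn (@wghost (zpoly R) n)).
case: n => [|n].
  exists (wcoord (wlift x) 0).
  by rewrite /ghost !big_ord1 subnn expn0 !expr1 !mulr1n add0r expn1.
rewrite ghost_versch ghostS mulrnDl -mulrnA -expnSr.
by exists (wcoord (wlift x) n.+1).
Qed.

Lemma wcoord0_mulrp x : wcoord (x *+ p) 0 = 0.
Proof. by rewrite witt_mulrp. Qed.

Hypothesis perfR : bijective (fun a : R => a ^+ p).

Lemma witt_tf x : x *+ p = 0 -> x = 0.
Proof.
rewrite witt_mulrp => x0; apply: wittP => n.
apply: (bij_inj perfR) => /=.
have /(congr1 (fun z : witt p_pr R => wcoord z n.+1)) /= -> := x0.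
by rewrite expr0n eqn0Ngt prime_gt0.
Qed.

Lemma witt_divp x : exists y, x = teich p_pr (wcoord x 0) + y *+ p.
Proof.
case: perfR => r rK Kr.
exists (Witt p_pr (fun n => r (wcoord x n.+1))).
rewrite witt_mulrp {1}[x]witt_decomp; congr (_ + versch _).
by apply: wittP => n /=; rewrite Kr.
Qed.

End CharP.

(* x = \sum_(i >= 0) p ^+ i * [a i], the series converging p-adically.       *)
Definition teich_expansion (R : comNzRingType) (x : witt p_pr R) (a : nat -> R) :=
  forall n, exists y : witt p_pr R,
    x = \sum_(i < n) p%:R ^+ i * teich p_pr (a i) + p%:R ^+ n * y.

Lemma teich_expansion_exists (R : comNzRingType) (x : witt p_pr R) :
  p \in [pchar R] -> bijective (fun a : R => a ^+ p) ->
  exists a, teich_expansion x a.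
Proof.
move=> pcharR perfR.
have /choice[q qP] := witt_divp pcharR perfR.
exists (fun n => wcoord (iter n q x) 0) => n; exists (iter n q x).
elim: n => [|n IH]; first by rewrite big_ord0 add0r mul1r.
rewrite big_ord_recr /= -addrA exprSr -mulrA -mulrDr mulr_natl.
by rewrite -qP.
Qed.

Lemma teich_expansion_unique (R : comNzRingType) (x : witt p_pr R) a b :
  p \in [pchar R] -> bijective (fun a : R => a ^+ p) ->
  teich_expansion x a -> teich_expansion x b -> a =1 b.
Proof.
move=> pcharR perfR xa xb n; elim/ltn_ind: n => n IH.
have [y] := xa n.+1; have [z ->] := xb n.+1; rewrite !big_ord_recr /=.
rewrite (eq_bigr (fun i : 'I_n => p%:R ^+ i * teich p_pr (a i))); last first.
  by move=> i _; rewrite IH.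
move/eqP; rewrite -!addrA (inj_eq (addrI _)) !exprSr -!mulrA -!mulrDr.
rewrite -subr_eq0 -mulrBr => /eqP.
have tf (u : witt p_pr R) : p%:R ^+ n * u = 0 -> u = 0.
  by rewrite -natrX mulr_natl => /(tf_exp (witt_tf pcharR perfR)).
move=> /tf/eqP; rewrite subr_eq0 => /eqP /(congr1 (wghost 0)).
rewrite !rmorphD !rmorphM !rmorph_nat !(pcharf0 pcharR) !mul0r !addr0.
move=> /= e; rewrite -(wcoord_teich0 (a n)) -(wcoord_teich0 (b n)) -!wghost0E.
by rewrite e.
Qed.

End WittTheory.

Record mulNorm (R : realType) (K : fieldType) : Type := MulNorm {
  mnorm :> K -> R;
  mnorm_ge0 : forall x, 0 <= mnorm x;
  mnorm_eq0 : forall x, (mnorm x == 0) = (x == 0);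
  mnormM : forall x y, mnorm (x * y) = mnorm x * mnorm y;
  mnormB : forall x y, mnorm (x - y) <= Num.max (mnorm x) (mnorm y)
}.

Definition mnorm_cauchy (R : realType) (K : fieldType) (alpha : mulNorm R K)
    (s : nat -> K) : Prop :=
  forall e : R, 0 < e -> exists N : nat,
    forall m n, (N <= m)%N -> (N <= n)%N -> alpha (s m - s n) < e.

Definition mnorm_cvg (R : realType) (K : fieldType) (alpha : mulNorm R K)
    (s : nat -> K) (l : K) : Prop :=
  forall e : R, 0 < e -> exists N : nat,
    forall n, (N <= n)%N -> alpha (s n - l) < e.

Definition mnorm_complete (R : realType) (K : fieldType) (alpha : mulNorm R K) :
    Prop :=
  forall s, mnorm_cauchy alpha s -> exists l, mnorm_cvg alpha s l.

Section ValuationRing.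
Context (R : realType) (K : fieldType) (alpha : mulNorm R K).

Lemma mnorm0 : alpha 0 = 0.
Proof. by apply/eqP; rewrite mnorm_eq0. Qed.

Lemma mnorm1 : alpha 1 = 1.
Proof.
have a1 : alpha 1 != 0 by rewrite mnorm_eq0 oner_eq0.
by apply: (mulfI a1); rewrite mulr1 -mnormM mulr1.
Qed.

Lemma mnormX x n : alpha (x ^+ n) = alpha x ^+ n.
Proof. by elim: n => [|n IH]; rewrite ?expr0 ?mnorm1 // !exprS mnormM IH. Qed.

Definition mnorm_ball : {pred K} := fun x => alpha x <= 1.

Fact mnorm_ball_subring_closed : subring_closed mnorm_ball.
Proof.
split=> [|x y xb yb|x y xb yb]; rewrite unfold_in ?mnorm1 //.
  by rewrite (le_trans (mnormB _ _ _)) // ge_max; apply/andP; split.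
by rewrite mnormM mulr_ile1 // mnorm_ge0.
Qed.

HB.instance Definition _ :=
  GRing.isSubringClosed.Build K mnorm_ball mnorm_ball_subring_closed.

Record valring : Type := ValRing { vval : K; _ : vval \in mnorm_ball }.

HB.instance Definition _ := [isSub for vval].
HB.instance Definition _ := [Choice of valring by <:].
HB.instance Definition _ := [SubChoice_isSubComNzRing of valring by <:].

Implicit Types u v : valring.

Definition vunit : {pred valring} := fun u => alpha (\val u) == 1.

Definition vinv u : valring := if u \in vunit then insubd u (\val u)^-1 else u.

Lemma val_vinv u : u \in vunit -> \val (vinv u) = (\val u)^-1.
Proof.
move=> uu; rewrite /vinv uu val_insubd.
suff -> : (\val u)^-1 \in mnorm_ball by [].
have u0 : \val u != 0 by rewrite -(mnorm_eq0 alpha) (eqP uu) oner_eq0.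
have := mnorm1; rewrite -(divff u0) mnormM (eqP uu) mul1r => h.
by rewrite unfold_in h.
Qed.

Fact vmulVx : {in vunit, left_inverse 1 vinv *%R}.
Proof.
move=> u uu; apply: val_inj; rewrite rmorphM rmorph1 /= val_vinv // mulVf //.
by rewrite -(mnorm_eq0 alpha) (eqP uu) oner_eq0.
Qed.

Fact vunitPl u v : v * u = 1 -> vunit u.
Proof.
move=> /(congr1 val); rewrite rmorphM rmorph1 => /(congr1 alpha).
rewrite mnormM mnorm1 => vu.
have u1 : alpha (\val u) <= 1 := valP u.
have v1 : alpha (\val v) <= 1 := valP v.
by rewrite /vunit eq_le u1 /= -vu ler_piMl ?mnorm_ge0.
Qed.

Fact vinv_out : {in [predC vunit], vinv =1 id}.
Proof. by move=> u; rewrite inE /vinv => /negPf->. Qed.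

HB.instance Definition _ :=
  GRing.ComNzRing_hasMulInverse.Build valring vmulVx vunitPl vinv_out.

Fact valring_integral : GRing.integral_domain_axiom valring.
Proof.
move=> u v /(congr1 val); rewrite rmorphM rmorph0 => /eqP.
by rewrite mulf_eq0 -!(rmorph0 (val : valring -> K)) !(inj_eq val_inj).
Qed.

HB.instance Definition _ :=
  GRing.ComUnitRing_isIntegral.Build valring valring_integral.

Lemma valring_pchar p : p \in [pchar K] -> p \in [pchar valring].
Proof.
move=> /andP[p_pr /eqP p0]; apply/andP; split=> //.
by apply/eqP/val_inj; rewrite rmorph_nat rmorph0.
Qed.

Lemma valring_perfect p : prime p ->
  bijective (fun x : K => x ^+ p) -> bijective (fun u : valring => u ^+ p).
Proof.
move=> p_pr [r rK Kr].
have rP u : r (\val u) \in mnorm_ball.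
  have u1 : alpha (\val u) <= 1 := valP u.
  have pn0 : p != 0%N by rewrite -lt0n prime_gt0.
  rewrite unfold_in leNgt; apply/negP => r1; move: u1.
  by rewrite -(Kr (\val u)) mnormX leNgt exprn_egt1 ?pn0.
pose s u : valring := Sub (r (\val u)) (rP u).
have sE u : \val (s u) = r (\val u) by rewrite SubK.
by exists s => u; apply: val_inj; rewrite ?sE rmorphXn ?sE; [exact: rK | exact: Kr].
Qed.

(* The expansion of x exists and is unique when K is perfect of              *)
(* characteristic p: see teich_expansion_exists and teich_expansion_unique.  *)
Definition stable (p : nat) (p_pr : prime p) (x : witt p_pr valring) : Prop :=
  exists2 a : nat -> valring, teich_expansion x a &
    (forall i, alpha (\val (a i)) = 0) \/
    (forall i, (0 < i)%N -> p%:R ^- i * alpha (\val (a i)) < alpha (\val (a 0%N))).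

End ValuationRing.

(* Main.v *)
Require Import Defs.
From mathcomp Require Import all_boot all_order all_algebra fraction generic_quotient.
From mathcomp Require Import boolp reals.
From mathcomp Require Import ring.

(* Write [x_i] for the Teichmueller digits of [x] and [o] for the valuation ring.
   A factor [p - [u]] with [|u| <= 1/p] multiplies [|x_0|] by at most [1/p], and
   [p = p - [0]], so only finitely many factors can be removed from [x] and it is
   enough to find one when [x_0 != 0] and [x] is not stable.

   For [u != 0], an element of [W(o)] is divisible by [p - [u]] modulo [p ^ (k+1)] as
   soon as the [k]-th digit of [x / (p - [u])], computed over the fraction field, is
   integral.  Up to a power of [u], this digit is a function [G_k(u)] with
   [G_k(0) = x_0] which becomes a polynomial in [u] after raising to some power
   [p ^ m].  The Newton polygon of [sum_(i <= k) x_i T^i] yields a zero of [G_k] with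
   [|u| <= 1/p] for large [k].  A zero [u] of [G_k] satisfies
   [|G_(k+1)(u)| <= |u| ^ (k+1)], which forces a zero of [G_(k+1)] close to [u]: the
   number of zeros of [G_k ^ (p ^ m)] of norm at most [1/p] is [O(p ^ m)] uniformly
   in [k], because [G_k(0) = x_0] and [G_k] maps [o] to itself.  The zeros so
   obtained converge to the required [u]. *)

Set Implicit Arguments.
Unset Strict Implicit.
Unset Printing Implicit Defensive.

Import Order.TTheory GRing.Theory Num.Theory.
Local Open Scope ring_scope.

(** * Teichmueller digits of a Witt vector *)

Section PerfectWitt.
Context (p : nat) (p_pr : prime p) (A : idomainType).
Context (pcharA : p \in [pchar A]) (rt : A -> A).
Hypotheses (rtK : cancel (fun a => a ^+ p) rt) (Krt : cancel rt (fun a => a ^+ p)).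
Local Notation W := (witt p_pr A).
Local Notation tau := (teich p_pr).
Local Notation P := (p%:R : W).
Implicit Types (x y z w : W) (a b c u : A).

Let perfA : bijective (fun a : A => a ^+ p).
Proof. by exists rt. Qed.

Lemma coord0D x y : wcoord (x + y) 0 = wcoord x 0 + wcoord y 0.
Proof. by rewrite -!wghost0E rmorphD. Qed.

Lemma coord0N x : wcoord (- x) 0 = - wcoord x 0.
Proof. by rewrite -!wghost0E raddfN. Qed.

Lemma coord0M x y : wcoord (x * y) 0 = wcoord x 0 * wcoord y 0.
Proof. by rewrite -!wghost0E rmorphM. Qed.

Lemma coord0p : wcoord P 0 = 0 :> A.
Proof. by rewrite -(wghost0E P) rmorph_nat (pcharf0 pcharA). Qed.

Lemma coord0pM x : wcoord (P * x) 0 = 0.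
Proof. by rewrite coord0M coord0p mul0r. Qed.

Lemma coord0_sum (I : Type) (s : seq I) (F : I -> W) :
  wcoord (\sum_(i <- s) F i) 0 = \sum_(i <- s) wcoord (F i) 0.
Proof.
by rewrite -wghost0E rmorph_sum; apply: eq_bigr => i _; exact: wghost0E.
Qed.

Lemma teich0 : tau (0 : A) = 0.
Proof. by apply: wittP => -[]. Qed.

Lemma teichX a n : tau (a ^+ n) = tau a ^+ n.
Proof. by elim: n => // n IH; rewrite !exprS teichM IH. Qed.

Lemma pM_inj x y : P * x = P * y -> x = y.
Proof.
move=> /eqP; rewrite -subr_eq0 -mulrBr mulr_natl => /eqP.
by move=> /(witt_tf pcharA perfA)/eqP; rewrite subr_eq0 => /eqP.
Qed.

(** In characteristic [p], multiplication by [p] sends [(a_0, a_1, ...)] to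
    [(0, a_0^p, a_1^p, ...)], so this is [(x - [x_0]) / p]. *)
Definition wshift x : W := Witt p_pr (fun n => rt (wcoord x n.+1)).

Lemma wshiftE x : x = tau (wcoord x 0) + P * wshift x.
Proof.
rewrite mulr_natl (witt_mulrp pcharA) {1}[x]witt_decomp; congr (_ + versch _).
by apply: wittP => n /=; rewrite Krt.
Qed.

Lemma wshift_eq a z : wshift (tau a + P * z) = z.
Proof.
apply: pM_inj; have := wshiftE (tau a + P * z).
by rewrite coord0D coord0pM addr0 wcoord_teich0 => /addrI.
Qed.

Lemma wshift_pM z : wshift (P * z) = z.
Proof. by rewrite -[RHS](wshift_eq 0) teich0 add0r. Qed.

Lemma coord0_eq0 x : wcoord x 0 = 0 -> x = P * wshift x.
Proof. by move=> x0; rewrite {1}[x]wshiftE x0 teich0 add0r. Qed.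

(* [x] is the sum of the [p ^ n [digit x n]]. *)
Definition digit x n := wcoord (iter n wshift x) 0.

Lemma digit0 x : digit x 0 = wcoord x 0.
Proof. by []. Qed.

Lemma digitS x n : digit x n.+1 = digit (wshift x) n.
Proof. by rewrite /digit iterSr. Qed.

Lemma digit_pM x n : digit (P * x) n.+1 = digit x n.
Proof. by rewrite digitS wshift_pM. Qed.

Lemma digit_pXM x n : digit (P ^+ n * x) n = wcoord x 0.
Proof.
elim: n => [|n IH]; first by rewrite expr0 mul1r.
by rewrite exprS -mulrA digit_pM.
Qed.

Lemma digitE x n :
  x = \sum_(i < n) P ^+ i * tau (digit x i) + P ^+ n * iter n wshift x.
Proof.
elim: n => [|n IH]; first by rewrite big_ord0 add0r expr0 mul1r.
rewrite big_ord_recr /= exprSr -mulrA -addrA -mulrDr -wshiftE; exact: IH.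
Qed.

(** * Congruences modulo a Teichmueller element and a power of [p] *)

Definition in_ideal c n z := exists w t, z = tau c * w + P ^+ n * t.

Lemma wshift_teichM c w : wshift (tau c * w) = tau c * wshift w.
Proof. by rewrite {1}[w]wshiftE mulrDr -teichM mulrCA wshift_eq. Qed.

Lemma digit_teichM c w n : digit (tau c * w) n = c * digit w n.
Proof.
elim: n w => [|n IH] w; first by rewrite !digit0 coord0M wcoord_teich0.
by rewrite !digitS wshift_teichM IH.
Qed.

(** Multiplication by [tau c] multiplies every digit by [c], and the first [n] digits ignore
    multiples of [P ^+ n]; conversely the quotients of the digits by [c] assemble into a suitable
    [w]. *)
Lemma in_idealP c n z :
  in_ideal c n z <-> forall j, (j < n)%N -> exists b, digit z j = c * b.
Proof.
split; last first.
  move=> /(_ _ _)/cid h.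
  pose b j := if ltnP j n is LtnNotGeq lt then sval (h j lt) else 0.
  have bE j : (j < n)%N -> digit z j = c * b j.
    by rewrite /b; case: ltnP => // lt _; case: (h j lt).
  exists (\sum_(i < n) P ^+ i * tau (b i)), (iter n wshift z).
  rewrite {1}(digitE z n) mulr_sumr; congr (_ + _); apply: eq_bigr => i _.
  by rewrite bE // teichM mulrCA.
move=> [w [t ->]]; elim: n w t => // n IH w t [|j] jn.
  exists (wcoord w 0).
  by rewrite digit0 coord0D coord0M exprS -mulrA coord0pM addr0.
rewrite digitS.
suff -> : wshift (tau c * w + P ^+ n.+1 * t) = tau c * wshift w + P ^+ n * t.
  exact: IH.
rewrite {1}[w]wshiftE mulrDr -teichM [tau c * (P * _)]mulrCA exprS -mulrA.
by rewrite -addrA -mulrDr wshift_eq.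
Qed.

Lemma in_idealD c n y z : in_ideal c n y -> in_ideal c n z -> in_ideal c n (y + z).
Proof.
move=> [w [t ->]] [w' [t' ->]]; exists (w + w'), (t + t').
by rewrite !mulrDr addrACA.
Qed.

Lemma in_idealM c n y z : in_ideal c n z -> in_ideal c n (y * z).
Proof.
move=> [w [t ->]]; exists (y * w), (y * t).
by rewrite mulrDr !(mulrCA y).
Qed.

Lemma in_ideal_sum c n (I : Type) (s : seq I) (F : I -> W) :
  (forall i, in_ideal c n (F i)) -> in_ideal c n (\sum_(i <- s) F i).
Proof.
move=> h; elim/big_ind: _ => //; last exact: in_idealD.
by exists 0, 0; rewrite !mulr0 addr0.
Qed.

Lemma in_ideal_teich c b n w : in_ideal c n (tau (c * b) * w).
Proof. by exists (tau b * w), 0; rewrite teichM mulr0 addr0 mulrA. Qed.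

Lemma in_ideal_teich_id c n w : in_ideal c n (tau c * w).
Proof. by exists w, 0; rewrite mulr0 addr0. Qed.

Lemma in_ideal_pX c n w : in_ideal c n (P ^+ n * w).
Proof. by exists 0, w; rewrite mulr0 add0r. Qed.

Lemma in_ideal_pM c n z : in_ideal c n.+1 (P * z) -> in_ideal c n z.
Proof.
move=> /in_idealP h; apply/in_idealP => j jn.
by have [b bE] := h j.+1 jn; exists b; rewrite -bE digit_pM.
Qed.

Lemma in_ideal_last c n z b :
  in_ideal c n z -> digit z n = c * b -> in_ideal c n.+1 z.
Proof.
move=> /in_idealP h zn; apply/in_idealP => j; rewrite ltnS leq_eqVlt.
by case/orP => [/eqP->|/h//]; exists b.
Qed.

(* The [p ^ n]-th roots of [a] and [b] are congruent modulo [e], so their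
   Teichmueller lifts are congruent modulo [e] and [p]; raise to the power [p ^ n]. *)
Lemma teich_congr a b e f n :
  a = b + e ^+ (p ^ n) * f -> in_ideal e n.+1 (tau a - tau b).
Proof.
move=> ab.
have rtX m c : iter m rt c ^+ (p ^ m) = c.
  elim: m c => [|m IH] c; first by rewrite expr1.
  by rewrite iterS expnS exprM Krt.
have pnat_pn m : [pchar A].-nat (p ^ m)%N.
  by rewrite pnatX (eq_pnat _ (pcharf_eq pcharA)) pnat_id // orbT.
pose a' := iter n rt a; pose b' := iter n rt b; pose f' := iter n rt f.
have a'E : a' = b' + e * f'.
  have inj m : injective (fun c : A => c ^+ (p ^ m)).
    elim: m => [|m IH] c d //=; rewrite !expnSr !exprM.
    by move=> /(can_inj rtK); exact: IH.
  by apply: (inj n); rewrite /= exprDn_pchar // exprMn !rtX.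
have : pcong p 1 (tau a') (tau b' + tau (e * f')).
  have : wcoord (tau a' - (tau b' + tau (e * f'))) 0 = 0.
    by rewrite coord0D coord0N coord0D !wcoord_teich0 a'E subrr.
  move=> /coord0_eq0/eqP; rewrite subr_eq addrC mulr_natl => /eqP ->.
  by eexists; rewrite expn1.
move=> /(pcong_exppn n)[t]; rewrite -teichX rtX => ->.
have /(congr1 (fun z => z + tau b ))/= := subrXX (tau b' + tau (e * f')) (tau b') (p ^ n).
rewrite -[tau b' ^+ _]teichX rtX subrK => ->.
rewrite addrAC addrK [_ + tau (e * f')]addrC addrK -mulr_natl natrX.
by apply: in_idealD; [exact: in_ideal_teich | exact: in_ideal_pX].
Qed.

(** * Divisibility by [p - [u]] modulo powers of [p] *)

(* In [W(Frac A)], [geom k u * x] is [- [u] ^ (k+1) * (x / (p - [u]))] modulo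
   [p ^ (k+1)]; its last digit decides whether [x] is divisible by [p - [u]]
   modulo [p ^ (k+1)] in [W(A)]. *)
Definition geom k u : W := \sum_(i < k.+1) P ^+ (k - i) * tau u ^+ i.

Lemma geomP k u : (P - tau u) * geom k u = P ^+ k.+1 - tau u ^+ k.+1.
Proof. by rewrite /geom subrXX. Qed.

Lemma geom0 k : geom k 0 = P ^+ k.
Proof.
rewrite /geom big_ord_recl /= teich0 expr0 mulr1 subn0 big1 ?addr0 // => i _.
by rewrite expr0n mulr0.
Qed.

Definition gdigit k x u := digit (geom k u * x) k.

Lemma gdigit0 k x : gdigit k x 0 = wcoord x 0.
Proof. by rewrite /gdigit geom0 digit_pXM. Qed.

Definition root_mod k x u := exists w t, x = (P - tau u) * w + P ^+ k * t.

(* With [z := geom k u * x], [p z = [u] z] modulo [[u ^ (k+1)]] and [p ^ (k+1)], so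
   divisibility of [z] by a power of [u] improves one exponent at a time. *)
Lemma gdigit_root_mod k x u b :
  u != 0 -> gdigit k x u = u ^+ k.+1 * b -> root_mod k.+1 x u.
Proof.
move=> u0 xb; set z := geom k u * x.
have : in_ideal (u ^+ k.+1) k.+1 z.
  have : forall j, (j <= k.+1)%N -> in_ideal (u ^+ j) k.+1 z; last exact.
  elim=> [|j IH] jk.
    apply/in_idealP => i _; exists (digit z i).
    by rewrite expr0 mul1r.
  have [w [t zE]] := IH (ltnW jk).
  apply: (@in_ideal_last _ _ _ (u ^+ (k - j) * b)).
    apply: in_ideal_pM.
    have -> : P * z = tau u * z + (P ^+ k.+1 * x - tau u ^+ k.+1 * x).
      by rewrite -mulrBl -geomP -mulrA -/z mulrBl addrC subrK.
    apply: in_idealD.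
      rewrite zE mulrDr mulrA -teichM -exprS [tau u * (P ^+ _ * t)]mulrCA.
      apply: in_idealD; last exact: in_ideal_pX.
      exact: in_ideal_teich_id.
    apply: in_idealD; first exact: in_ideal_pX.
    rewrite -mulrN -teichX -(subnKC jk) exprD; exact: in_ideal_teich.
  by rewrite -/(gdigit k x u) xb mulrA -exprD addSn subnKC.
move=> [w [t zE]].
(* For [c = 0] the ideal consists of the multiples of [P ^+ k.+1]. Modulo it, the digit criterion
   cancels the factor [tau (u ^+ k.+1)], since [u != 0] and [A] is a domain. *)
have : in_ideal 0 k.+1 (tau (u ^+ k.+1) * ((P - tau u) * w + x)).
  exists 0, (x - (P - tau u) * t); rewrite teich0 mul0r add0r.
  have /(congr1 (fun s : W => s * x)) := geomP k u.
  rewrite -mulrA -/z zE teichX => e.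
  rewrite mulrDr mulrBr mulrCA.
  apply/eqP; rewrite -subr_eq0; apply/eqP.
  move/eqP: e; rewrite -subr_eq0 => /eqP <-; ring.
move=> /in_idealP h; have : in_ideal 0 k.+1 ((P - tau u) * w + x).
  apply/in_idealP => j /h [d].
  have -> : digit (tau (u ^+ k.+1) * ((P - tau u) * w + x)) j =
    u ^+ k.+1 * digit ((P - tau u) * w + x) j.
    exact: digit_teichM.
  rewrite mul0r => /eqP; rewrite mulf_eq0 expf_eq0 (negPf u0) /= => /eqP ->.
  by exists 0; rewrite mul0r.
move=> [w' [t']]; rewrite teich0 mul0r add0r => e.
by exists (- w), t'; rewrite -e mulrN addKr.
Qed.

(** Every term of [geom k.+1 u] but the last, [[u] ^ (k+1)], carries a factor [p], so modulo
    [p ^ (k+2)] only the last one sees the error [P ^+ k.+1 * t]; [geomP] handles the exact multiple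
    of [p - [u]]. Thus a zero of [gdigit k] makes [gdigit k.+1] small. *)
Lemma root_mod_gdigit k x u :
  root_mod k.+1 x u -> exists b, gdigit k.+1 x u = u ^+ k.+1 * b.
Proof.
move=> [w [t xE]].
have : in_ideal (u ^+ k.+1) k.+2 (geom k.+1 u * x).
  rewrite xE mulrDr mulrA [_ * (P - _)]mulrC geomP mulrBl -mulrN.
  apply: in_idealD.
    apply: in_idealD; first exact: in_ideal_pX.
    rewrite -teichX [u ^+ k.+2]exprSr; exact: in_ideal_teich.
  rewrite /geom big_ord_recr /= subnn expr0 mul1r mulrDl.
  apply: in_idealD.
    rewrite big_distrl /=; apply: in_ideal_sum => i.
    have ik : (i <= k)%N by rewrite -ltnS.
    have -> : P ^+ (k.+1 - i) * tau u ^+ i * (P ^+ k.+1 * t) =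
        P ^+ k.+2 * (P ^+ (k - i) * (tau u ^+ i * t)).
      by rewrite subSn // [P ^+ (k - i).+1]exprS [P ^+ k.+2]exprS; ring.
    exact: in_ideal_pX.
  by rewrite -teichX; exact: in_ideal_teich_id.
by move=> /in_idealP; apply.
Qed.

(** Modulo [[u a]] and [p ^ (k+1)], the term [p ^ (k-j) [u] ^ j x] reduces to [p ^ k [u ^ j x_j]]: a
    digit [x_i] with [i < j] enters through [[u] ^ (j-i) [u ^ i x_i]], a multiple of [[u a]], and
    one with [i > j] has too many factors [p]. The remaining sum of Teichmueller elements is
    divisible by [p], because the [u ^ j x_j] add up to [0]. *)
Lemma gdigit_start k x u a :
    (forall i, (i <= k)%N -> exists b, u ^+ i * digit x i = a * b) ->
    \sum_(i < k.+1) u ^+ i * digit x i = 0 ->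
  exists b, gdigit k x u = u * a * b.
Proof.
move=> xa x0.
suff : in_ideal (u * a) k.+1 (geom k u * x) by move=> /in_idealP; apply.
have -> : geom k u * x =
    \sum_(j < k.+1) (P ^+ (k - j) * tau u ^+ j * x - P ^+ k * tau (u ^+ j * digit x j))
    + P ^+ k * \sum_(j < k.+1) tau (u ^+ j * digit x j).
  by rewrite sumrB -mulr_sumr subrK big_distrl.
apply: in_idealD; last first.
  rewrite (@coord0_eq0 (\sum_(j < k.+1) _)); last first.
    by rewrite coord0_sum -[RHS]x0; apply: eq_bigr.
  by rewrite mulrA -exprSr; exact: in_ideal_pX.
apply: in_ideal_sum => j.
have jk : (j <= k)%N by rewrite -ltnS.
have pkE : P ^+ k = P ^+ (k - j) * P ^+ j by rewrite -exprD subnK.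
rewrite {1}(digitE x j.+1) mulrDr.
have -> : P ^+ (k - j) * tau u ^+ j * (P ^+ j.+1 * iter j.+1 wshift x) =
    P ^+ k.+1 * (tau u ^+ j * iter j.+1 wshift x).
  by rewrite [P ^+ k.+1]exprS pkE [P ^+ j.+1]exprS; ring.
rewrite addrAC; apply: in_idealD; last exact: in_ideal_pX.
rewrite big_ord_recr /= mulrDr teichM teichX.
have -> : P ^+ (k - j) * tau u ^+ j * (P ^+ j * tau (digit x j)) =
  P ^+ k * (tau u ^+ j * tau (digit x j)).
  by rewrite pkE; ring.
rewrite addrK big_distrr /=; apply: in_ideal_sum => i.
have ij : (i <= j)%N by rewrite ltnW.
have [b bE] := xa i (leq_trans ij jk).
have -> : P ^+ (k - j) * tau u ^+ j * (P ^+ i * tau (digit x i)) =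
   P ^+ (k - j) * P ^+ i * tau u ^+ (j - i).-1 * (tau u * tau (u ^+ i * digit x i)).
  have -> : tau u ^+ j = tau u ^+ (j - i).-1 * tau u * tau u ^+ i.
    by rewrite -exprSr prednK ?subn_gt0 // -exprD subnK.
  by rewrite teichM teichX; ring.
by rewrite bE -teichM mulrA; apply: in_idealM; rewrite -[tau _]mulr1; exact: in_ideal_teich.
Qed.

Lemma root_mod_coord0 k x u : root_mod k.+1 x u -> exists b, wcoord x 0 = u * b.
Proof.
move=> [w [t ->]]; exists (- wcoord w 0).
rewrite coord0D exprS -mulrA coord0pM addr0 coord0M coord0D coord0N coord0p add0r.
by rewrite wcoord_teich0 mulrN mulNr.
Qed.

(** * Limits in the [p]-adic topology *)

Lemma pXM_eq0 x : (forall n, exists t, x = P ^+ n * t) -> x = 0.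
Proof.
move=> h; apply: wittP => n /=.
have [t ->] := h n.+1; elim: n t {h} => [|n IH] t.
  by rewrite expr1 coord0pM.
rewrite exprS -mulrA mulr_natl (witt_mulrp pcharA) /= IH expr0n.
by case: p p_pr.
Qed.

Lemma teich_series (s : nat -> A) : exists y, digit y =1 s.
Proof.
(* The Witt coordinates of the sum of the [p ^ n [s_n]] are the [s_n ^ (p ^ n)]; [Y k] is the series
   of the tail starting at [s_k]. *)
pose Y k := Witt p_pr (fun n => s (n + k)%N ^+ (p ^ n)).
have YE k : wshift (Y k) = Y k.+1.
  apply: wittP => n /=; rewrite expnSr exprM addSnnS; exact: rtK.
exists (Y 0) => n; rewrite /digit.
have -> : iter n wshift (Y 0) = Y n by elim: n => //= n ->.
by rewrite /= expr1.
Qed.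

(* For a suitable [a], [x - (p - [u]) [a]] is [p] times an element that is again
   divisible by [p - [u]] modulo every power of [p]. *)
Lemma root_mod_limit x u :
  u != 0 -> (forall n, root_mod n x u) -> exists y, x = (P - tau u) * y.
Proof.
move=> u0 xr.
pose ok z := forall n, root_mod n z u.
have /choice[f fP] : forall z, exists az : A * W,
    ok z -> z = (P - tau u) * tau az.1 + P * az.2 /\ ok az.2.
  move=> z; have [okz|nokz] := pselect (ok z); last by exists (0, 0).
  have [b bE] := root_mod_coord0 (okz 1%N).
  have /coord0_eq0 : wcoord (z - (P - tau u) * tau (- b)) 0 = 0.
    rewrite coord0D coord0N coord0M coord0D coord0N coord0p add0r !wcoord_teich0 bE.
    by rewrite mulrNN subrr.
  set z' := wshift _ => /eqP; rewrite subr_eq addrC => /eqP zE.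
  exists (- b, z') => _; split=> // n.
  have [w [t wE]] := okz n.+1.
  have e : P * (z' - P ^+ n * t) = (P - tau u) * (w - tau (- b)).
    by move: zE; rewrite {1}wE exprS => /eqP; rewrite -subr_eq0 => /eqP h;
       apply/eqP; rewrite -subr_eq0 -oppr_eq0 -h; apply/eqP; ring.
  (* By [e], [P] divides [(P - tau u) * (w - tau (- b))]; as [u != 0], it divides the second factor,
     and cancelling [P] in [e] settles [z']. *)
  have : wcoord (w - tau (- b)) 0 = 0.
    have /eqP := congr1 (fun y => wcoord y 0) e.
    rewrite coord0pM coord0M coord0D coord0N coord0p add0r wcoord_teich0 eq_sym.
    by rewrite mulf_eq0 oppr_eq0 (negPf u0) => /eqP.
  move=> /coord0_eq0 wb; exists (wshift (w - tau (- b))), t.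
  apply/eqP; rewrite -subr_eq; apply/eqP; apply: pM_inj.
  by rewrite e {1}wb mulrCA.
pose X n := iter n (fun z => (f z).2) x.
have okX n : ok (X n) by elim: n => //= n /fP[].
have [y yE] := teich_series (fun n => (f (X n)).1).
exists y; apply/eqP; rewrite -subr_eq0; apply/eqP/pXM_eq0 => n.
exists (X n - (P - tau u) * iter n wshift y).
elim: n => [|n IH]; first by rewrite expr0 mul1r.
rewrite IH exprSr -mulrA; congr (_ * _).
have [XnE _] := fP _ (okX n).
rewrite {1}XnE [iter n wshift y]wshiftE -[wcoord (iter n _ _) 0]/(digit y n) yE /=.
ring.
Qed.


(** * Functions that become polynomials after a [p]-power *)

(* These are the polynomial functions of the [p]-power roots of the variable. *)
Definition root_poly (F : A -> A) :=
  exists m (Q : {poly A}), forall u, F u ^+ (p ^ m) = Q.[u].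

Lemma root_polyD F G :
  root_poly F -> root_poly G -> root_poly (fun u => F u + G u).
Proof.
move=> [m [Q QE]] [n [S SE]].
exists (m + n)%N, (Q ^+ (p ^ n) + S ^+ (p ^ m)) => u.
rewrite exprDn_pchar; last first.
  by rewrite pnatX (eq_pnat _ (pcharf_eq pcharA)) pnat_id // orbT.
by rewrite hornerD !horner_exp -QE -SE -!exprM -!expnD (addnC n m).
Qed.

Lemma root_polyM F G :
  root_poly F -> root_poly G -> root_poly (fun u => F u * G u).
Proof.
move=> [m [Q QE]] [n [S SE]].
exists (m + n)%N, (Q ^+ (p ^ n) * S ^+ (p ^ m)) => u.
by rewrite exprMn hornerM !horner_exp -QE -SE -!exprM -!expnD (addnC n m).
Qed.

Lemma root_polyC c : root_poly (fun=> c).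
Proof. by exists 0, c%:P => u; rewrite hornerC expr1. Qed.

Lemma root_poly_id : root_poly id.
Proof. by exists 0, 'X => u; rewrite hornerX expr1. Qed.

Lemma root_polyX F n : root_poly F -> root_poly (fun u => F u ^+ n).
Proof.
move=> [m [Q QE]]; exists m, (Q ^+ n) => u.
by rewrite horner_exp -QE -!exprM mulnC.
Qed.

Lemma root_poly_rt F : root_poly F -> root_poly (fun u => rt (F u)).
Proof.
by move=> [m [Q QE]]; exists m.+1, Q => u; rewrite expnS exprM Krt.
Qed.

Lemma root_poly_zeval (I : choiceType) (F : A -> I -> A) (g : zpoly I) :
  (forall i, root_poly (F^~ i)) -> root_poly (fun u => zeval (F u) g).
Proof.
move=> FP; rewrite /zeval /monalg.mmap.
set s := finmap.enum_fset _; elim: s => [|m s IH].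
  under eq_fun do rewrite big_nil.
  exact: root_polyC.
under eq_fun do rewrite big_cons.
apply: root_polyD => //; apply: root_polyM; first exact: root_polyC.
rewrite /cmeval; set t := finmap.enum_fset _; elim: t => [|i t IHt].
  under eq_fun do rewrite big_nil; exact: root_polyC.
under eq_fun do rewrite big_cons.
by apply: root_polyM => //; apply: root_polyX.
Qed.

Definition root_poly_witt (X : A -> W) :=
  forall n, root_poly (fun u => wcoord (X u) n).

Lemma root_poly_weval X Y g : root_poly_witt X -> root_poly_witt Y ->
  root_poly (fun u => weval (X u) (Y u) g).
Proof.
move=> XP YP; apply: (@root_poly_zeval _
  (fun u i => if i.1 then wcoord (X u) i.2 else wcoord (Y u) i.2)).
by case=> -[] n /=; [exact: XP | exact: YP].
Qed.

Lemma root_poly_wittD X Y : root_poly_witt X -> root_poly_witt Y ->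
  root_poly_witt (fun u => X u + Y u).
Proof.
move=> XP YP n; under eq_fun do rewrite [wcoord _ _]wcoordD.
exact: root_poly_weval.
Qed.

Lemma root_poly_wittM X Y : root_poly_witt X -> root_poly_witt Y ->
  root_poly_witt (fun u => X u * Y u).
Proof.
move=> XP YP n; under eq_fun do rewrite [wcoord _ _]wcoordM.
exact: root_poly_weval.
Qed.

Lemma root_poly_wittC x : root_poly_witt (fun=> x).
Proof. by move=> n; exact: root_polyC. Qed.

Lemma root_poly_teich F : root_poly F -> root_poly_witt (fun u => tau (F u)).
Proof. by move=> FP [|n] //=; exact: root_polyC. Qed.

Lemma root_poly_wshift X :
  root_poly_witt X -> root_poly_witt (fun u => wshift (X u)).
Proof. by move=> XP n; apply: root_poly_rt. Qed.

(** Witt vector sums and products are integer polynomials in the coordinates, and [wshift] only adds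
    [p]-th roots. *)
Lemma root_poly_gdigit k x : root_poly (gdigit k x).
Proof.
have geomP' : root_poly_witt (geom k).
  rewrite /geom; elim: (index_enum _) => [|i s IH].
    under eq_fun do rewrite big_nil.
    exact: root_poly_wittC.
  under eq_fun do rewrite big_cons -teichX.
  apply: root_poly_wittD => //; apply: root_poly_wittM; first exact: root_poly_wittC.
  apply/root_poly_teich/root_polyX; exact: root_poly_id.
have : root_poly_witt (fun u => iter k wshift (geom k u * x)).
  elim: {1}k => [|n IH]; last exact: root_poly_wshift.
  exact/root_poly_wittM/root_poly_wittC.
by apply.
Qed.

End PerfectWitt.

(** * Roots of polynomials over an ultrametric field *)

Section NormedField.
Context (R : realType) (K : fieldType) (alpha : mulNorm R K).
Implicit Types (x y r : K) (Q : {poly K}) (s : seq K).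

Lemma mnormN x : alpha (- x) = alpha x.
Proof.
have le y : alpha (- y) <= alpha y.
  by rewrite -[- y]sub0r (le_trans (mnormB _ _ _)) // mnorm0 ge_max mnorm_ge0 /=.
by apply/eqP; rewrite eq_le le -{1}[x]opprK le.
Qed.

Lemma mnormD x y : alpha (x + y) <= Num.max (alpha x) (alpha y).
Proof. by rewrite -(mnormN y) -{1}[y]opprK mnormB. Qed.

Lemma mnormB_dominant x y : alpha x < alpha y -> alpha (x - y) = alpha y.
Proof.
move=> xy; apply/eqP; rewrite eq_le; apply/andP; split.
  by rewrite (le_trans (mnormB _ _ _)) // ge_max lexx ltW.
have := mnormB alpha x (x - y); rewrite opprB addrC subrK.
by rewrite le_max leNgt xy.
Qed.

Lemma mnorm_prod (I : Type) (s : seq I) (F : I -> K) :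
  alpha (\prod_(i <- s) F i) = \prod_(i <- s) alpha (F i).
Proof. exact: (big_morph (mnorm alpha) (mnormM alpha) (mnorm1 alpha)). Qed.

Lemma mnorm_prodXsubC c s x :
  alpha (c *: \prod_(r <- s) ('X - r%:P)).[x] = alpha c * \prod_(r <- s) alpha (x - r).
Proof.
rewrite hornerZ horner_prod mnormM mnorm_prod; congr (_ * _).
by apply: eq_bigr => r _; rewrite hornerXsubC.
Qed.

(** Up to sign, the [i]-th coefficient is [c] times a sum of products that omit [i] of the roots,
    and each omitted root has norm at least [t]. *)
Lemma mnorm_coef_prodXsubC c s (t : R) i : 0 <= t ->
    {in s, forall r, t <= alpha r} ->
  alpha (c *: \prod_(r <- s) ('X - r%:P))`_i * t ^+ i <=
  alpha (c *: \prod_(r <- s) ('X - r%:P))`_0.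
Proof.
move=> t0; elim: s i => [|r s IH] i sP.
  rewrite big_nil !coefZ !coef1 eqxx; case: i => [|i] /=.
    by rewrite expr0 mulr1.
  by rewrite mulr0 mnorm0 mul0r mnorm_ge0.
have rt : t <= alpha r by apply: sP; rewrite mem_head.
have {}IH j := IH j (fun q (qs : q \in s) => sP q (mem_behead (s := r :: s) qs)).
rewrite big_cons scalerAr; set S := c *: _ in IH *.
rewrite mulrBl !coefB !coefXM !coefCM /= sub0r mnormN mnormM.
have h : alpha (r * S`_i) * t ^+ i <= alpha r * alpha S`_0.
  by rewrite mnormM -mulrA ler_wpM2l ?mnorm_ge0.
case: i h => [|i] h /=; first by rewrite sub0r mnormN.
apply: (@le_trans _ _ (Num.max (alpha S`_i) (alpha (r * S`_i.+1)) * t ^+ i.+1)).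
  by rewrite ler_wpM2r ?exprn_ge0 // mnormB.
rewrite maxr_pMl ?exprn_ge0 // ge_max h andbT exprS mulrCA.
by rewrite ler_pM ?mulr_ge0 ?exprn_ge0 ?mnorm_ge0.
Qed.

Hypothesis closedK : forall Q, size Q != 1%N -> exists x, root Q x.

Lemma poly_prodXsubC Q : exists c s, Q = c *: \prod_(r <- s) ('X - r%:P).
Proof.
elim: (size Q).+1 {-2}Q (ltnSn (size Q)) => // n IH {}Q Qn.
have [Q1|/closedK[r /factor_theorem[S SE]]] := eqVneq (size Q) 1%N.
  exists Q`_0, [::]; rewrite big_nil alg_polyC; apply: size1_polyC; rewrite Q1 //.
have [S0|S0] := eqVneq S 0.
  by exists 0, [::]; rewrite SE S0 mul0r scale0r.
have [c [s sE]] : exists c s, S = c *: \prod_(r <- s) ('X - r%:P).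
  by apply: IH; move: Qn; rewrite SE size_Mmonic ?monicXsubC // size_XsubC addn2.
by exists c, (r :: s); rewrite big_cons scalerAr -sE SE mulrC.
Qed.

(** A root of least norm works, that norm serving as [t] in [mnorm_coef_prodXsubC]; this is the
    first slope of the Newton polygon. *)
Lemma minimal_root Q : (1 < size Q)%N ->
  exists2 r, root Q r & forall i, alpha Q`_i * alpha r ^+ i <= alpha Q`_0.
Proof.
have [c [s ->]] := poly_prodXsubC Q.
case: s => [|r0 s].
  by rewrite big_nil alg_polyC size_polyC; case: (c != 0).
move=> _; have [r rs rmin] : exists2 r, r \in r0 :: s & {in r0 :: s, forall q, alpha r <= alpha q}.
  elim: s r0 => [|q s IH] r0.
    by exists r0 => [|q]; rewrite !inE // => /eqP->.
  have [r rs rmin] := IH q; have [le|lt] := leP (alpha r0) (alpha r).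
    exists r0 => [|x]; first exact: mem_head.
    by rewrite inE => /orP[/eqP->//|/rmin]; exact: le_trans.
  exists r => [|x]; first by rewrite inE rs orbT.
  by rewrite inE => /orP[/eqP->|/rmin//]; exact: ltW.
exists r => [|i]; last by apply: mnorm_coef_prodXsubC; rewrite ?mnorm_ge0.
rewrite rootE hornerZ (eqP (_ : root (\prod_(r <- r0 :: s) ('X - r%:P)) r)).
  by rewrite mulr0.
by rewrite root_prod_XsubC.
Qed.

(* There is a point of the unit ball at distance 1 from each point of [s]:
   take a root of [prod_(r <- s) (X - r) - 1]. *)
Lemma unit_ball_avoid s : {in s, forall r, alpha r <= 1} ->
  exists2 x, alpha x <= 1 & {in s, forall r, alpha (x - r) = 1}.
Proof.
have [->|s0] := eqVneq s [::] => sP; first by exists 0 => //; rewrite mnorm0.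
have [x] : exists x, root (\prod_(r <- s) ('X - r%:P) - 1) x.
  apply: closedK.
  rewrite size_polyDl ?size_prod_XsubC ?size_polyN ?size_poly1 //.
    by rewrite eqSS -lt0n lt0n size_eq0.
  by rewrite ltnS lt0n size_eq0.
rewrite rootE hornerD hornerN hornerC subr_eq0 => /eqP/(congr1 alpha).
rewrite mnorm1 -[\prod_(_ <- _) _]scale1r mnorm_prodXsubC mnorm1 mul1r => x1.
have xle : alpha x <= 1.
  rewrite leNgt; apply/negP => xgt.
  move: x1; rewrite (eq_big_seq (fun=> alpha x)) => [|r rs].
    rewrite big_const_seq count_predT iter_mulr_1 => /eqP.
    by rewrite pexpr_eq1 ?mnorm_ge0 ?lt0n ?size_eq0 // => /eqP e; rewrite e ltxx in xgt.
  by rewrite -opprB mnormN mnormB_dominant // (le_lt_trans (sP _ rs)).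
exists x => // r rs.
have le1 q : q \in s -> alpha (x - q) <= 1.
  by move=> /sP q1; rewrite (le_trans (mnormB _ _ _)) // ge_max xle.
apply/eqP; rewrite eq_le le1 //= -x1 (big_rem r) //.
rewrite ler_piMr ?mnorm_ge0 // big_seq prodr_ile1 // => q /mem_rem qs.
by rewrite mnorm_ge0 le1.
Qed.

(** Replacing [0] by [x] does not change the distance to a root of norm above [rho]. If every other
    root were farther than [delta] from [x], then [|Q(x)| >= |Q(0)| delta ^ m], with [m] the number
    of roots of norm at most [rho]; and [m <= D] because [rho ^ D <= |Q(0)| <= rho ^ m]. *)
Lemma nearby_root Q (rho delta : R) (D : nat) x :
    0 < rho < 1 -> 0 < delta <= 1 -> (forall y, alpha y <= 1 -> alpha Q.[y] <= 1) ->
    0 < alpha Q.[0] -> rho ^+ D <= alpha Q.[0] -> alpha x <= rho ->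
    alpha Q.[x] < alpha Q.[0] * delta ^+ D ->
  exists r, [/\ root Q r, alpha r <= rho & alpha (x - r) <= delta].
Proof.
move=> /andP[rho_gt0 rho1] /andP[d0 d1] Qball Q0 QD xrho Qx.
have rho0 := ltW rho_gt0.
apply: contrapT => noroot.
have [c [s QE]] := poly_prodXsubC Q.
have rP r : r \in s -> alpha r <= rho -> delta < alpha (x - r).
  move=> rs rrho; rewrite ltNge; apply/negP => xr; apply: noroot; exists r.
  split=> //; rewrite QE rootE hornerZ.
  by rewrite (eqP (_ : root (\prod_(r <- s) ('X - r%:P)) r)) ?mulr0 // root_prod_XsubC.
pose small r := alpha r <= rho.
pose m := count small s.
(* At such a [y] the value of [Q] has the Gauss norm of [Q], namely [|c|] times the product of the
   [max(1, |r|)]; so this norm is at most 1. *)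
have [y y1 ys] : exists2 y, alpha y <= 1 &
    {in [seq r <- s | alpha r <= 1], forall r, alpha (y - r) = 1}.
  by apply: unit_ball_avoid => r; rewrite mem_filter => /andP[].
have c1 : alpha c * \prod_(r <- s) Num.max 1 (alpha r) <= 1.
  suff <- : alpha Q.[y] = alpha c * \prod_(r <- s) Num.max 1 (alpha r) by exact: Qball.
  rewrite QE mnorm_prodXsubC; congr (_ * _); apply: eq_big_seq => r rs.
  have [r1|r1] := leP (alpha r) 1.
    by rewrite ys // mem_filter r1.
  by rewrite mnormB_dominant // (le_lt_trans y1).
have Q0E : alpha Q.[0] = alpha c * \prod_(r <- s) alpha r.
  by rewrite QE mnorm_prodXsubC; congr (_ * _); apply: eq_bigr => r _; rewrite sub0r mnormN.
have prod_small (t : R) : \prod_(r <- s) (if small r then t else 1) = t ^+ m.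
  by rewrite -big_mkcond /= big_const_seq iter_mulr_1.
have mD : rho ^+ D <= rho ^+ m.
  apply: (le_trans QD); rewrite Q0E.
  apply: (@le_trans _ _ (alpha c *
      \prod_(r <- s) (Num.max 1 (alpha r) * (if small r then rho else 1)))).
    rewrite ler_wpM2l ?mnorm_ge0 //; apply: ler_prod => r _; rewrite mnorm_ge0 /=.
    case: ifP => [rr|_]; last by rewrite mulr1 le_max lexx orbT.
    by rewrite (le_trans rr) // ler_peMl // le_max lexx.
  by rewrite big_split mulrA prod_small /= ler_piMl ?exprn_ge0.
have {}mD : delta ^+ D <= delta ^+ m.
  by rewrite ler_wiXn2l ?(ltW d0) //; move: mD; rewrite ler_iXn2l.
have : alpha Q.[0] * delta ^+ m <= alpha Q.[x].
  rewrite Q0E -mulrA -prod_small -big_split QE mnorm_prodXsubC /=.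
  rewrite ler_wpM2l ?mnorm_ge0 // !big_seq; apply: ler_prod => r rs.
  rewrite mulr_ge0 ?mnorm_ge0 //=; last by case: ifP => // _; rewrite ltW.
  case: ifP => [rr|/negbT].
    rewrite (le_trans _ (ltW (rP r rs rr))) //.
    by rewrite ler_piMl ?(ltW d0) // (le_trans rr (ltW rho1)).
  by rewrite -ltNge mulr1 => rr; rewrite mnormB_dominant // (le_lt_trans xrho).
by rewrite leNgt (lt_le_trans Qx) // ler_wpM2l // ltW.
Qed.

End NormedField.

(** * The valuation ring and its fraction field *)

Lemma fraction_numden (A : idomainType) (y : {fraction A}) :
  exists n d : A, d != 0 /\ y * FracField.tofrac d = FracField.tofrac n.
Proof.
elim/quotW: y => y; exists y.1, y.2; split; first exact: denom_ratioP.
unlock FracField.tofrac; rewrite -[LHS]FracField.pi_mul; apply/eqmodP.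
rewrite /= FracField.equivfE /FracField.mulf !numden_Ratio ?mulf_neq0 ?oner_neq0 ?denom_ratioP //.
by rewrite !mulr1 mulrC.
Qed.

Section ValuationRingRoots.
Context (R : realType) (K : fieldType) (alpha : mulNorm R K).
Local Notation O := (valring alpha).
Local Notation v u := (alpha (\val (u : O))).

Lemma valring_eq0 (b : O) : (\val b == 0) = (b == 0).
Proof. by rewrite -(rmorph0 (val : O -> K)) (inj_eq val_inj). Qed.

Lemma valring_lift (a : K) : alpha a <= 1 -> exists u : O, \val u = a.
Proof. by move=> a1; exists (ValRing (a1 : a \in mnorm_ball alpha)). Qed.

Lemma valring_dvd (a b : O) : b != 0 -> v a <= v b -> exists c, a = b * c.
Proof.
move=> b0 ab; have vb0 : \val b != 0 by rewrite valring_eq0.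
have vb_gt0 : 0 < v b by rewrite lt_def mnorm_eq0 vb0 mnorm_ge0.
have [c cE] : exists c : O, \val c = \val a / \val b.
  apply: valring_lift; rewrite -(ler_pM2r vb_gt0) mul1r -mnormM divfK //.
by exists c; apply: val_inj; rewrite rmorphM /= cE mulrC divfK.
Qed.

Lemma common_denominator (s : seq K) :
  exists2 d : O, d != 0 & {in s, forall a, alpha (\val d * a) <= 1}.
Proof.
elim: s => [|a s [d d0 dP]]; first by exists 1 => //; exact: oner_neq0.
have [e e0 ea] : exists2 e : O, e != 0 & alpha (\val e * a) <= 1.
  have [a1|a1] := leP (alpha a) 1.
    by exists 1; rewrite ?oner_neq0 // rmorph1 mul1r.
  have a0 : a != 0 by rewrite -(mnorm_eq0 alpha) gt_eqF // (lt_trans ltr01).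
  have aV : alpha a^-1 * alpha a = 1 by rewrite -mnormM mulVf // mnorm1.
  have [e eE] : exists e : O, \val e = a^-1.
    apply: valring_lift; rewrite -aV ler_peMr ?mnorm_ge0 // ltW //.
  exists e; last by rewrite eE mulVf // mnorm1.
  by rewrite -valring_eq0 eE invr_eq0.
exists (d * e) => [|b]; first by rewrite mulf_neq0.
rewrite rmorphM inE => /orP[/eqP->|/dP db].
  by rewrite -mulrA mnormM mulr_ile1 ?mnorm_ge0 //; exact: (valP d).
by rewrite mulrAC mnormM mulr_ile1 ?mnorm_ge0 //; exact: (valP e).
Qed.

(** Write [Q(T) = 0] as [T ^ (n+1) = sum_(i <= n) c_i T ^ i]. A common denominator [d] gives the
    integral equation with coefficients [d ^ (n+1-i) c_i]; its root [s / t] in [{fraction O}] yields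
    the root [s / (t d)] of [Q] in [K]. *)
Lemma closed_fraction_root (Q : {poly K}) :
  GRing.closed_field_axiom {fraction O} -> size Q != 1%N -> exists x, root Q x.
Proof.
move=> closed Q1; have [->|Q0] := eqVneq Q 0; first by exists 0; rewrite root0.
have [n nE] : exists n, size Q = n.+2.
  by case: (size Q) (size_poly_eq0 Q) Q1 => [|[|n]]; rewrite ?(negPf Q0) // => _ _; exists n.
pose c i := - Q`_i / lead_coef Q.
have [d d0 dP] := common_denominator [seq c i | i <- iota 0 n.+1].
have vd0 : \val d != 0 by rewrite valring_eq0.
have /choice[a aE] : forall i, exists a : O, (i < n.+1)%N -> \val a = \val d ^+ (n.+1 - i) * c i.
  move=> i; have [lin|_] := ltnP i n.+1; last by exists 0.
  suff [a aE] : exists a : O, \val a = \val d ^+ (n.+1 - i) * c i by exists a.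
  apply: valring_lift; rewrite subSn // exprSr -mulrA mnormM mulr_ile1 ?mnorm_ge0 //.
    by rewrite mnormX exprn_ile1 ?mnorm_ge0 //; exact: (valP d).
  by apply: dP; apply: map_f; rewrite mem_iota.
have [y yE] := closed n.+1 (fun i => FracField.tofrac (a i)) isT.
have [s [t [t0 ytE]]] := fraction_numden y.
have sE : s ^+ n.+1 = \sum_(i < n.+1) a i * s ^+ i * t ^+ (n.+1 - i).
  apply/eqP; rewrite -tofrac_eq rmorphXn /= -ytE exprMn yE rmorph_sum mulr_suml.
  apply/eqP/eq_bigr => i _.
  rewrite !rmorphM !rmorphXn /= -ytE exprMn.
  have -> : FracField.tofrac t ^+ n.+1 = FracField.tofrac t ^+ (n.+1 - i) * FracField.tofrac t ^+ i.
    by rewrite -exprD subnK // ltnW.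
  ring.
have vt0 : \val t != 0 by rewrite valring_eq0.
have td0 : \val t * \val d != 0 by rewrite mulf_neq0.
exists (\val s / (\val t * \val d)); rewrite rootE horner_coef nE big_ord_recr /=.
have lE : Q`_n.+1 = lead_coef Q by rewrite lead_coefE nE.
have l0 : lead_coef Q != 0 by rewrite lead_coef_eq0.
have vsE : \val s ^+ n.+1 = \sum_(i < n.+1) \val (a i) * \val s ^+ i * \val t ^+ (n.+1 - i).
  rewrite -(rmorphXn (val : O -> K)) sE rmorph_sum.
  by apply: eq_bigr => i _; rewrite !rmorphM !rmorphXn.
rewrite lE expr_div_n vsE mulr_suml mulr_sumr -big_split /=.
rewrite big1 // => i _.
rewrite aE // expr_div_n /c.
have le : (i <= n.+1)%N by rewrite ltnW.
have -> : (\val t * \val d) ^+ n.+1 = (\val t * \val d) ^+ (n.+1 - i) * (\val t * \val d) ^+ i.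
  by rewrite -exprD subnK.
rewrite !exprMn; field.
by rewrite !expf_neq0.
Qed.


(** * Zeros of the functions [gdigit k x] *)

Hypothesis closedK : forall Q : {poly K}, size Q != 1%N -> exists x, root Q x.
Context (p : nat) (p_pr : prime p) (pcharO : p \in [pchar O]) (rt : O -> O).
Hypotheses (rtK : cancel (fun a : O => a ^+ p) rt)
  (Krt : cancel rt (fun a : O => a ^+ p)).
Local Notation W := (witt p_pr O).
Local Notation tau := (teich p_pr).
Local Notation rho := (p%:R^-1 : R).
Local Notation digit := (digit rt).
Local Notation gdigit := (gdigit rt).
Implicit Types (x y : W) (u : O).

Let v_ge0 (u : O) : 0 <= v u. Proof. exact: mnorm_ge0. Qed.
Let v_le1 (u : O) : v u <= 1. Proof. exact: (valP u). Qed.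
Let vM (a b : O) : v (a * b) = v a * v b.
Proof. by rewrite rmorphM mnormM. Qed.
Let v_gt0 (u : O) : (0 < v u) = (u != 0).
Proof. by rewrite lt_def mnorm_eq0 valring_eq0 v_ge0 andbT. Qed.
Let vX (u : O) n : v (u ^+ n) = v u ^+ n.
Proof. by rewrite rmorphXn mnormX. Qed.

Let rho_gt0 : 0 < rho.
Proof. by rewrite invr_gt0 ltr0n prime_gt0. Qed.
Let rho_lt1 : rho < 1.
Proof. by rewrite invf_lt1 ?ltr0n ?prime_gt0 // ltr1n prime_gt1. Qed.
Let rho_ge0 : 0 <= rho := ltW rho_gt0.
Let gd0 k x : gdigit k x 0 = wcoord x 0 := gdigit0 pcharO rtK Krt k x.

(** Apply [nearby_root] to the polynomial [F ^ (p ^ m)] with exponent [D * p ^ m]: the power [p ^ m]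
    cancels from the inequalities, so [delta] and [D] do not depend on [m]. *)
Lemma nearby_root_fun (F : O -> O) (delta : R) (D : nat) (u : O) :
    root_poly p F -> 0 < delta <= 1 -> F 0 != 0 -> rho ^+ D <= v (F 0) ->
    v u <= rho -> v (F u) < v (F 0) * delta ^+ D ->
  exists r, [/\ F r = 0, v r <= rho & v (u - r) <= delta].
Proof.
move=> [m [Q QE]] d01 F0 FD ur Fu; have /andP[d0 d1] := d01.
pose S := map_poly (val : O -> K) Q.
have SE a : S.[\val a] = \val (F a ^+ (p ^ m)) by rewrite QE horner_map.
have vS a : alpha S.[\val a] = v (F a) ^+ (p ^ m) by rewrite SE vX.
have S0 : alpha S.[0] = v (F 0) ^+ (p ^ m) by rewrite -vS rmorph0.
have pm0 : (p ^ m)%N != 0%N by rewrite -lt0n expn_gt0 prime_gt0.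
have [|||||||r [Sr rr ur']] := @nearby_root R K alpha closedK S rho delta (D * p ^ m) (\val u).
- by rewrite rho_gt0.
- by [].
- by move=> y /valring_lift[a <-]; rewrite SE; exact: v_le1.
- by rewrite S0 exprn_gt0 // v_gt0.
- by rewrite S0 exprM ler_pXn2r ?lt0n ?nnegrE ?exprn_ge0.
- by [].
- by rewrite vS S0 exprM -exprMn ltr_pXn2r ?nnegrE ?lt0n ?mulr_ge0 ?exprn_ge0 ?(ltW d0).
have [a aE] := valring_lift (le_trans rr (ltW rho_lt1)).
exists a; rewrite -aE in Sr rr ur'; split=> //.
move: Sr; rewrite rootE SE => /eqP/eqP; rewrite valring_eq0 expf_eq0.
by rewrite lt0n pm0 => /eqP.
Qed.

Lemma expr_rho_small (e : R) : 0 < e -> exists n, rho ^+ n <= e.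
Proof.
move=> e0; exists (Num.bound e^-1); rewrite exprVn -[leRHS]invrK.
rewrite lef_pV2 ?posrE ?exprn_gt0 ?invr_gt0 ?ltr0n ?prime_gt0 //.
apply: (@le_trans _ _ (Num.bound e^-1)%:R).
  by rewrite ltW // archi_boundP // invr_ge0 ltW.
by rewrite -natrX ler_nat ltnW // ltn_expl ?prime_gt1.
Qed.

(** A least root of the polynomial with coefficients [x_0, ..., x_k] has norm at most [rho], for
    otherwise its [i]-th term would exceed [x_0]. There [gdigit_start] with [a = x_0] makes
    [gdigit k x] smaller than at [0]. *)
Lemma gdigit_root_start x k i : wcoord x 0 != 0 -> (0 < i <= k)%N ->
    v (wcoord x 0) <= rho ^+ i * v (digit x i) ->
  exists2 u, v u <= rho & gdigit k x u = 0.
Proof.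
move=> x0 /andP[i0 ik] xi.
have [D rhoD] : exists D, rho ^+ D <= v (wcoord x 0).
  by apply: expr_rho_small; rewrite v_gt0.
have xi_gt0 : 0 < v (digit x i).
  rewrite lt_def v_ge0 andbT; apply: contraTneq xi => ->.
  by rewrite mulr0 -ltNge v_gt0.
pose Q : {poly K} := \poly_(j < k.+1) \val (digit x j).
have QE j : (j <= k)%N -> Q`_j = \val (digit x j).
  by rewrite coef_poly ltnS => ->.
have sQ : (1 < size Q)%N.
  rewrite ltnNge; apply/negP => sQ.
  have := QE i ik; rewrite nth_default ?(leq_trans sQ) // => /esym e.
  by rewrite e mnorm0 ltxx in xi_gt0.
have [r Qr rmin] := minimal_root alpha closedK sQ.
have rr : alpha r <= rho.
  rewrite leNgt; apply/negP => rr.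
  have := rmin i; rewrite !QE //; apply/negP; rewrite -ltNge.
  apply: (le_lt_trans xi); rewrite mulrC ltr_pM2l // ltrXn2r ?ltW //.
  by rewrite -lt0n.
have [u uE] := valring_lift (le_trans rr (ltW rho_lt1)).
rewrite -{r}uE in Qr rmin rr.
have [||b bE] := gdigit_start pcharO rtK Krt (k := k) (x := x) (u := u) (a := wcoord x 0).
- move=> j jk; apply: valring_dvd => //.
  by rewrite vM vX mulrC; have := rmin j; rewrite !QE.
- apply: val_inj; rewrite rmorph0 rmorph_sum -[RHS](eqP Qr) horner_poly.
  by apply: eq_bigr => j _; rewrite rmorphM rmorphXn mulrC.
(* Any zero of norm at most [rho] will do, so [delta = 1]. *)
have [||||||r [r0 rr' _]] := @nearby_root_fun (gdigit k x) 1 D u.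
- exact: (root_poly_gdigit pcharO Krt).
- by rewrite ltr01 lexx.
- by rewrite gd0.
- by rewrite gd0.
- by [].
- rewrite gd0 // expr1n mulr1 bE !vM.
  apply: (@le_lt_trans _ _ (v u * v (wcoord x 0))).
    by rewrite ler_piMr ?mulr_ge0.
  by rewrite gtr_pMl ?v_gt0 // (le_lt_trans rr).
by exists r.
Qed.

Lemma gdigit_root_step x k D u : wcoord x 0 != 0 -> rho ^+ D <= v (wcoord x 0) ->
    (0 < D <= k)%N -> v u <= rho -> gdigit k x u = 0 ->
  exists u', [/\ v u' <= rho, gdigit k.+1 x u' = 0 & v (u - u') <= rho ^+ (k %/ D).-1].
Proof.
move=> x0 xD /andP[D0 Dk] ur xu.
have u0 : u != 0 by apply: contraNneq x0 => u0; rewrite -xu u0 gd0.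
have [b bE] : exists b, gdigit k.+1 x u = u ^+ k.+1 * b.
  apply: (root_mod_gdigit pcharO rtK Krt).
  by apply: (gdigit_root_mod pcharO rtK Krt (b := 0)); rewrite ?mulr0.
(* With this [delta], [rho ^ D * delta ^ D] is [rho ^ (D * (k %/ D))], whose exponent is at most
   [k]; it therefore exceeds [rho ^ (k+1)]. The predecessor is genuine because [D <= k]. *)
have [||||||r [r0 rr ur']] := @nearby_root_fun (gdigit k.+1 x) (rho ^+ (k %/ D).-1) D u.
- exact: (root_poly_gdigit pcharO Krt).
- by rewrite exprn_gt0 // exprn_ile1 // ltW.
- by rewrite gd0.
- by rewrite gd0.
- by [].
- rewrite gd0 // bE vM vX.
  apply: (@le_lt_trans _ _ (rho ^+ k.+1)).
    apply: (@le_trans _ _ (v u ^+ k.+1)); first by rewrite ler_piMr ?exprn_ge0.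
    by rewrite lerXn2r ?nnegrE // ltW.
  apply: (@lt_le_trans _ _ (rho ^+ D * (rho ^+ (k %/ D).-1) ^+ D)); last first.
    by rewrite ler_pM2r // !exprn_gt0.
  rewrite -exprM -exprD ltr_iXn2l // ltnS -{1}[D]mul1n -mulnDl add1n prednK.
    exact: leq_trunc_div.
  by rewrite divn_gt0.
by exists r.
Qed.

(** * Convergence of the zeros to an exact divisor *)

Hypothesis completeK : mnorm_complete alpha.

Lemma witt_root x i : wcoord x 0 != 0 -> (0 < i)%N ->
    v (wcoord x 0) <= rho ^+ i * v (digit x i) ->
  exists u y, v u <= rho /\ x = y * (p%:R - tau u).
Proof.
move=> x0 i0 xi.
have [D [D0 xD]] : exists D, (0 < D)%N /\ rho ^+ D <= v (wcoord x 0).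
  have [|D h] := @expr_rho_small (v (wcoord x 0)); first by rewrite v_gt0.
  exists D.+1; split=> //; apply: le_trans h.
  by rewrite exprS ler_piMl ?exprn_ge0 // ltW.
(* [gdigit_root_start] needs [k0 >= i], and [gdigit_root_step] needs [k0 >= D]. *)
pose k0 := maxn i D.
have [u0 u0r u0E] : exists2 u, v u <= rho & gdigit k0 x u = 0.
  by apply: (gdigit_root_start x0 _ xi); rewrite i0 leq_maxl.
have /choice[f fP] : forall ku : nat * O, exists u', (D <= ku.1)%N -> v ku.2 <= rho ->
    gdigit ku.1 x ku.2 = 0 -> [/\ v u' <= rho, gdigit ku.1.+1 x u' = 0 &
    v (ku.2 - u') <= rho ^+ (ku.1 %/ D).-1].
  move=> [k u]; have [[Dk [ur xu]]|h] := pselect ((D <= k)%N /\ v u <= rho /\ gdigit k x u = 0).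
    have [|u' u'P] := @gdigit_root_step x k D u x0 xD _ ur xu; first by rewrite D0.
    by exists u'.
  by exists 0 => Dk ur xu; case: h.
pose s := fix s n := if n is n'.+1 then f ((k0 + n')%N, s n') else u0.
have sP n : v (s n) <= rho /\ gdigit (k0 + n) x (s n) = 0.
  elim: n => [|n [sr sE]] /=; first by rewrite addn0.
  have [|||? ? _] := fP ((k0 + n)%N, s n) => //=; last by rewrite addnS.
  by rewrite (leq_trans (leq_maxr i D)) // leq_addr.
have sS n : v (s n - s n.+1) <= rho ^+ ((k0 + n) %/ D).-1.
  have [sr sE] := sP n.
  have [|||_ _] := fP ((k0 + n)%N, s n) => //=.
  by rewrite (leq_trans (leq_maxr i D)) // leq_addr.
have s0 n : s n != 0.
  by have [_] := sP n; apply: contra_eq_neq => ->; rewrite gd0.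
have sroot n : root_mod (k0 + n).+1 x (s n).
  by apply: (gdigit_root_mod pcharO rtK Krt (b := 0)); rewrite ?mulr0 //; case: (sP n).
have s_cauchy e n j : (D * e.+1 <= n)%N -> v (s n - s (n + j)%N) <= rho ^+ e.
  move=> en; elim: j => [|j IH]; first by rewrite addn0 subrr rmorph0 mnorm0 exprn_ge0 // ltW.
  have -> : s n - s (n + j.+1)%N = (s n - s (n + j)%N) + (s (n + j)%N - s (n + j).+1).
    by rewrite addnS addrA subrK.
  rewrite rmorphD (le_trans (mnormD _ _ _)) // ge_max IH (le_trans (sS _)) //.
  rewrite ler_iXn2l //; have : (e.+1 <= (k0 + (n + j)) %/ D)%N.
    by rewrite leq_divRL // mulnC (leq_trans en) // addnCA leq_addr.
  by case: (_ %/ _)%N.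
have [e e0|l lP] := completeK (s := fun n => \val (s n)).
  have [E EP] := @expr_rho_small (e / 2) (divr_gt0 e0 (ltr0Sn _ _)).
  exists (D * E.+1)%N => m n mE nE.
  have h j : (D * E.+1 <= j)%N -> v (s (D * E.+1)%N - s j) < e.
    move=> jE; rewrite -(subnKC jE) (le_lt_trans (s_cauchy E _ _ _)) //.
    by rewrite (le_lt_trans EP) // ltr_pdivrMr // ltr_pMr // ltr1n.
  have -> : \val (s m) - \val (s n) =
     \val (s (D * E.+1)%N - s n) - \val (s (D * E.+1)%N - s m).
    by rewrite !rmorphB; ring.
  by rewrite (le_lt_trans (mnormB _ _ _)) // gt_max !h.
have lr : alpha l <= rho.
  have [n nP] := lP rho rho_gt0.
  have -> : l = \val (s n) - (\val (s n) - l) by rewrite opprB addrC subrK.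
  rewrite (le_trans (mnormB _ _ _)) // ge_max (ltW (nP n _)) // andbT.
  by have [] := sP n.
have [u uE] := valring_lift (le_trans lr (ltW rho_lt1)).
exists u; rewrite -{l}uE in lr lP.
(* Each [s n] divides [x_0], hence has norm at least [|x_0|], and cannot tend to [0]. *)
have u_neq0 : u != 0.
  apply/eqP => uz; have [|n nP] := lP (v (wcoord x 0)); first by rewrite v_gt0.
  have := nP n (leqnn n); rewrite uz rmorph0 subr0; apply/negP; rewrite -leNgt.
  have [b ->] := root_mod_coord0 pcharO (sroot n).
  by rewrite vM ler_piMr.
have xroot N : root_mod N x u.
  case: N => [|N]; first by exists 0, x; rewrite mulr0 add0r expr0 mul1r.
  (* By [teich_congr], [s n = u] modulo this [e] gives [[s n] = [u]] modulo [[u ^ (N+1)]] and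
     [p ^ (N+2)]. *)
  pose e := (u ^+ N.+1) ^+ (p ^ N.+1).
  have e_neq0 : e != 0 by rewrite !expf_neq0.
  have [|M MP] := lP (v e); first by rewrite v_gt0.
  pose n := maxn M N.
  have [c cE] : exists c, s n - u = e * c.
    by apply: valring_dvd => //; rewrite ltW // rmorphB MP // leq_maxl.
  have [w [t wE]] : in_ideal (u ^+ N.+1) N.+2 (tau (s n) - tau u).
    apply: (teich_congr p_pr pcharO rtK Krt (f := c)).
    by rewrite -/e -cE addrC subrK.
  have [z [q xE]] := sroot n.
  (* The error [[u] ^ (N+1) w z] is absorbed through [[u] ^ (N+1) = p ^ (N+1) - (p - [u]) * geom N
     u]. *)
  exists (z + geom p_pr N u * w * z),
    (p%:R ^+ (k0 + n - N) * q - w * z - p%:R * t * z).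
  have pE : (p%:R : W) ^+ (k0 + n).+1 = p%:R ^+ N.+1 * p%:R ^+ (k0 + n - N).
    rewrite -exprD addSn subnKC // (leq_trans (leq_maxr M N)) //; exact: leq_addl.
  rewrite xE pE -[tau (s n)](subrK (tau u)) wE teichX.
  have -> : (p%:R - tau u) * (z + geom p_pr N u * w * z) =
      (p%:R - tau u) * z + (p%:R - tau u) * geom p_pr N u * w * z by ring.
  rewrite geomP [p%:R ^+ N.+2]exprS.
  ring.
have [y yE] := root_mod_limit pcharO rtK Krt u_neq0 xroot.
by exists y; rewrite mulrC.
Qed.

(** * Removing the factors one at a time *)

Lemma not_stable_digit x : ~ stable x ->
  exists2 i, (0 < i)%N & v (wcoord x 0) <= rho ^+ i * v (digit x i).
Proof.
move=> xns; apply: contrapT => noi; apply: xns; exists (digit x).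
  by move=> n; exists (iter n (wshift rt) x); exact: digitE.
right=> i i0; rewrite -exprVn ltNge; apply/negP => xi.
by apply: noi; exists i.
Qed.

Definition stable_factorization x := exists y (s : seq O),
  [/\ y != 0, stable y, {in s, forall u, v u <= rho} &
      x = y * \prod_(u <- s) (p%:R - tau u)].

Lemma stable_factorizationM x u :
  v u <= rho -> stable_factorization x -> stable_factorization (x * (p%:R - tau u)).
Proof.
move=> ur [y [s [y0 ys sr ->]]]; exists y, (u :: s); split=> //.
  by move=> w; rewrite inE => /orP[/eqP->|/sr].
by rewrite big_cons mulrA mulrAC.
Qed.

(* Each root multiplies the norm of the 0th digit by at least [p], and this norm stays at most 1. *)
Lemma stable_factorization_coord0 x :
  wcoord x 0 != 0 -> stable_factorization x.
Proof.
rewrite -v_gt0 => /expr_rho_small[N xN'].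
have xN : rho ^+ N.+1 < v (wcoord x 0).
  by rewrite (lt_le_trans _ xN') // exprS gtr_pMl // exprn_gt0.
elim: N.+1 x xN {xN'} => {N} [|N IH] x xN; first by move: xN; rewrite expr0 ltNge v_le1.
have x0 : wcoord x 0 != 0 by rewrite -v_gt0 (le_lt_trans _ xN) ?exprn_ge0.
have [xs|/not_stable_digit[i i0 xi]] := pselect (stable x).
  exists x, [::]; split=> //; last by rewrite big_nil mulr1.
  by apply: contra_neq x0 => ->.
have [u [y [ur xE]]] := witt_root x0 i0 xi.
rewrite xE; apply: stable_factorizationM => //; apply: IH.
have x0E : v (wcoord x 0) = v (wcoord y 0) * v u.
  rewrite xE coord0M coord0D coord0N coord0p // add0r wcoord_teich0.
  by rewrite rmorphM rmorphN mnormM mnormN.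
rewrite -(ltr_pM2r rho_gt0) -exprSr (lt_le_trans xN) // x0E.
by rewrite ler_wpM2l.
Qed.

(** While the 0th coordinate vanishes, a factor [p = p - [0]] splits off, and the index [n] of a
    nonzero coordinate drops by one. *)
Lemma stable_factorization_neq0 x : x != 0 -> stable_factorization x.
Proof.
move=> xn0; have [n xn] : exists n, wcoord x n != 0.
  apply: contrapT => h; move/eqP: xn0; apply; apply: wittP => n /=.
  by apply/eqP; apply: contrapT => xn; apply: h; exists n; apply/negP.
elim: n x xn {xn0} => [|n IH] x xn; first exact: stable_factorization_coord0.
have [x0|] := eqVneq (wcoord x 0) 0; last exact: stable_factorization_coord0.
rewrite (coord0_eq0 pcharO Krt x0) mulrC -[p%:R]subr0 -(teich0 p_pr).
apply: stable_factorizationM; first by rewrite rmorph0 mnorm0.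
apply: IH => /=; apply: contra_neq xn => e.
by rewrite -(Krt (wcoord x n.+1)) e expr0n -[p]prednK ?prime_gt0.
Qed.

End ValuationRingRoots.

Theorem theorem6p8 (R : realType) (p : nat) (p_pr : prime p)
  (K : fieldType) (pcharK : p \in [pchar K])
  (perfectK : bijective (fun x : K => x ^+ p))
  (alpha : mulNorm R K) (completeK : mnorm_complete alpha)
  (closed_frac : GRing.closed_field_axiom {fraction (valring alpha)})
  (x : witt p_pr (valring alpha)) (x_neq0 : x != 0) (x_nstable : ~ stable x) :
  exists (y : witt p_pr (valring alpha)) (n : nat) (u : 'I_n -> valring alpha),
    [/\ y != 0,
        stable y,
        forall i, alpha (\val (u i)) <= p%:R^-1 &
        x = y * \prod_(i < n) (p%:R - teich p_pr (u i))].
Proof.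
have [rt rtK Krt] := valring_perfect alpha p_pr perfectK.
have closedK Q := closed_fraction_root (Q := Q) closed_frac.
have [y [s [y0 ys sr xE]]] :=
  stable_factorization_neq0 closedK (valring_pchar alpha pcharK) rtK Krt completeK x_neq0.
exists y, (size s), (tnth (in_tuple s)); split=> //.
  by move=> i; apply: sr; exact: mem_tnth.
by rewrite xE (big_tnth _ _ s).
Qed.
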